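(* There exists a universal constant $M>0$ such that the following holds. Let $X=(X_n)_{n\in\mathbb N}$ be a positive Harris recurrent aperiodic Markov chain on a countably generated state space $(E,\mathcal E)$ with transition kernel $P$ and initial measure $\nu$. Let $S$ be a $\Psi$-small set with $m=1$ such that $\sup_{x\in S}\mathbb E_x[\tau_S]<\infty$ and $\mathbb E_\nu[\tau_S]<\infty$, and let $A=S\times\{1\}$ be the atom of the associated split chain, with regeneration time $\tau_A$. Let $\mathcal F$ be a class of functions $E\to\mathbb R$ of VC type with constant envelope $U$ and characteristic $(C,v)$. Let $\sigma'^2$ be such that $$\mathbb E_A\Big[\Big(\sum_{i=1}^{\tau_A} f(X_i)\Big)^2\Big]\le \sigma'^2\qquad\text{for all } f\in\mathcal F .$$ Then for every $n\ge 1$ and every $L$ such that $0<\sigma'\le LU$: (i) if $p>1$ is such that $\mathbb E_A[\tau_A^p]<\infty$, then $$R_{n,B}(\mathcal F)\le M\left[vLU\log\frac{CLU}{\sigma'}+\sqrt{vn\sigma'^2\log\frac{CLU}{\sigma'}}\right]+\frac{nU\,\mathbb E_A[\tau_A^p]}{L^{p-1}};$$ (ii) if $\lambda>0$ is such that $\mathbb E_A[\exp(\lambda\tau_A)]<\infty$, then $$R_{n,B}(\mathcal F)\le M\left[vLU\log\frac{CLU}{\sigma'}+\sqrt{vn\sigma'^2\log\frac{CLU}{\sigma'}}\right]+nU\exp(-L\lambda/2)\,C_\lambda,$$ where $C_\lambda=2\,\mathbb E_A[\exp(\lambda\tau_A)]/\lambda$.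
   Context: Markov chain notions. $X$ is a time-homogeneous Markov chain; $\mathbb P_x,\mathbb E_x$ (resp. $\mathbb P_\nu,\mathbb E_\nu$) refer to the chain started at $X_0=x$ (resp. $X_0\sim\nu$). The chain is $\psi$-irreducible if there is a $\sigma$-finite measure $\psi$ such that $\psi(B)>0$ implies that for every $x\in E$ there is $n>0$ with $P^n(x,B)>0$. For $B\in\mathcal E$, $\tau_B$ is the time the chain first enters $B$ ($\tau_B=\inf\{n\ge1: X_n\in B\}$). A $\psi$-irreducible chain is positive Harris recurrent if $\mathbb E_x[\tau_B]<\infty$ for all $x\in B$ and all $B\in\mathcal E$ with $\psi(B)>0$. A set $S\in\mathcal E$ is $\Psi$-small (with integer $m\geq 1$) if there are $\delta>0$ and a probability measure $\Psi$ supported by $S$ with $P^m(x,B)\ge\delta\Psi(B)$ for all $x\in S$, $B\in\mathcal E$. Split chain. With $m=1$, the split chain is the Markov chain $Z=(X_n,Y_n)_{n\in\mathbb N}$ on $E\times\{0,1\}$, where $(Y_n)$ are independent Bernoulli($\delta$) variables and: if $X_n\in S$ and $Y_n=1$, then $X_{n+1}\sim\Psi$; if $X_n\in S$ and $Y_n=0$, then $X_{n+1}\sim(1-\delta)^{-1}(P(X_n,\cdot)-\delta\Psi(\cdot))$; if $X_n\notin S$, then $X_{n+1}\sim P(X_n,\cdot)$. The set $A=S\times\{1\}$ is an atom of $Z$. The regeneration times are $\tau_A=\tau_A(1)=\inf\{n\ge1: Z_n\in A\}$ and $\tau_A(j)=\inf\{n>\tau_A(j-1): Z_n\in A\}$ for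 $j\ge2$. $\mathbb P_A,\mathbb E_A$ refer to the split chain started in $A$ ($Z_0\in A$). Blocks. $B_k=(X_{1+\tau_A(k)},\dots,X_{\tau_A(k+1)})$, $k\ge1$; these are i.i.d. For $f:E\to\mathbb R$ put $f'(B_k)=\sum_{i=\tau_A(k)+1}^{\tau_A(k+1)}f(X_i)$. Block Rademacher complexity. $$R_{n,B}(\mathcal F)=\mathbb E_A\sup_{f\in\mathcal F}\Big|\sum_{k=1}^n\epsilon_k f'(B_k)\Big|,$$ where $(\epsilon_k)$ are i.i.d. Rademacher variables ($\pm1$ with probability $1/2$), independent of the blocks. VC type. A countable class $\mathcal F$ of measurable functions $E\to\mathbb R$ is of VC type for an envelope $F$ (i.e. $|f|\le F$ for all $f\in\mathcal F$) and characteristic $(C,v)$, where $v\ge1$ and $C\ge(3\sqrt e)^v$, if for every probability measure $Q$ on $(E,\mathcal E)$ with $0<\|F\|_{L_2(Q)}<\infty$ and every $0<\epsilon<1$, $\mathcal N(\epsilon\|F\|_{L_2(Q)},\mathcal F,\|\cdot\|_{L_2(Q)})\le C\epsilon^{-v}$. Here $\mathcal N(\epsilon,\mathcal F,d)$ is the minimal number of balls of size $\epsilon$ needed to cover $\mathcal F$, and $\|f\|_{L_2(Q)}=(\int f^2dQ)^{1/2}$. ''Constant envelope $U$'' means $F\equiv U$ for a constant $U>0$. *)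

(* Defs.v *)
From HB Require Import structures.
From mathcomp Require Import all_boot all_order all_algebra finmap.
From mathcomp Require Import all_classical all_reals all_analysis.

Set Implicit Arguments.
Unset Strict Implicit.
Unset Printing Implicit Defensive.

Import Order.TTheory GRing.Theory Num.Theory.
Import numFieldNormedType.Exports.

Local Open Scope classical_set_scope.
Local Open Scope ring_scope.

Definition countably_generated d (E : measurableType d) : Prop :=
  exists G : nat -> set E, @measurable d E = <<s range G >>.

Section GeneratedSigmaAlgebras.
Context dO (Om : measurableType dO) d (T : measurableType d).

Definition sigma_of (X : nat -> Om -> T) (I : set nat) : set (set Om) :=
  <<s \bigcup_(i in I) preimage_set_system setT (X i) measurable >>.

End GeneratedSigmaAlgebras.

Section Independence.
Context (R : realType) dO (Om : measurableType dO) (Pr : probability Om R).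
Local Open Scope ereal_scope.

Definition mutually_independent (I : choiceType) (G : I -> set (set Om)) : Prop :=
  forall (J : {fset I}) (A : I -> set Om), (forall i, i \in J -> G i (A i)) ->
    Pr (\bigcap_(i in [set` J]) A i) = \prod_(i <- J) Pr (A i).

Definition independent (G H : set (set Om)) : Prop :=
  forall A B, G A -> H B -> Pr (A `&` B) = Pr A * Pr B.

End Independence.

Section MarkovChains.
Context (R : realType).
Local Open Scope ereal_scope.

(* Under [Pr], P(X_{n+1} \in B | X_0, ..., X_n) = K(X_n, B) almost surely.  The
   kernel is only a set function here because the residual part of a split
   kernel is not a measure at the points that the chain never visits when
   delta = 1. *)
Definition markov_property dO (Om : measurableType dO) d (T : measurableType d)
    (K : T -> set T -> \bar R) (Pr : probability Om R)
    (X : nat -> {mfun Om >-> T}) : Prop :=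
  forall n (G : set Om) (B : set T),
    sigma_of (fun i => X i : Om -> T) `I_n.+1 G -> measurable B ->
    Pr (G `&` X n.+1 @^-1` B) = \int[Pr]_(w in G) K (X n w) B.

(* One process X on one space, together with a law [Pr mu] for each initial
   distribution mu; the law "P_x" is [Pr \d_x]. *)
Definition markov_family dO (Om : measurableType dO) d (E : measurableType d)
    (P : R.-pker E ~> E) (Pr : probability E R -> probability Om R)
    (X : nat -> {mfun Om >-> E}) : Prop :=
  forall mu : probability E R,
    (forall B, measurable B -> Pr mu (X 0%N @^-1` B) = mu B) /\
    markov_property (fun x => P x) (Pr mu) X.

(* Successive entrance times: tau(0) = 0 by convention, so that
   tau(1) = inf {n >= 1 : X_n \in B}.  The infimum of the empty set is +oo. *)
Fixpoint entrance_time (Om T : Type) (X : nat -> Om -> T) (B : set T) (j : nat)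
    (w : Om) : \bar R :=
  if j is i.+1 then
    ereal_inf [set n%:R%:E | n in
                 [set n | entrance_time X B i w < n%:R%:E /\ B (X n w)]]
  else 0.

Definition tau (Om T : Type) (X : nat -> Om -> T) (B : set T) : Om -> \bar R :=
  entrance_time X B 1.

Section Kernel.
Context d (E : measurableType d) (P : R.-pker E ~> E).

Fixpoint kernel_pow (n : nat) (x : E) (B : set E) : \bar R :=
  if n is m.+1 then \int[P x]_y kernel_pow m y B else \d_x B.

(* psi is required to be nonzero: every kernel is irreducible with respect to
   the zero measure. *)
Definition irreducible (psi : {measure set E -> \bar R}) : Prop :=
  [/\ sigma_finite setT psi, 0 < psi setT &
      forall B, measurable B -> 0 < psi B ->
        forall x, exists2 n, (0 < n)%N & 0 < kernel_pow n x B].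

(* D 0, ..., D (k - 1) is a k-cycle: disjoint sets visited in cyclic order,
   whose union is psi-full. *)
Definition is_cycle (psi : {measure set E -> \bar R}) (k : nat)
    (D : nat -> set E) : Prop :=
  [/\ forall i, (i < k)%N -> measurable (D i),
      trivIset `I_k D,
      forall i x, (i < k)%N -> D i x -> P x (D (i.+1 %% k)%N) = 1 &
      psi (~` \bigcup_(i in `I_k) D i) = 0].

Definition aperiodic (psi : {measure set E -> \bar R}) : Prop :=
  ~ exists k D, (2 <= k)%N /\ is_cycle psi k D.

Definition positive_harris (psi : {measure set E -> \bar R})
    dO (Om : measurableType dO) (Pr : probability E R -> probability Om R)
    (X : nat -> {mfun Om >-> E}) : Prop :=
  irreducible psi /\
  forall B, measurable B -> 0 < psi B ->
    forall x, B x -> \int[Pr \d_x]_w tau X B w < +oo.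

Definition small_set (m : nat) (S : set E) (delta : R) (Psi : probability E R)
    : Prop :=
  [/\ measurable S, (0 < delta)%R, Psi S = 1 &
      forall x B, S x -> measurable B -> delta%:E * Psi B <= kernel_pow m x B].

Definition split_fst (S : set E) (delta : R) (Psi : probability E R)
    (z : E * bool) (B : set E) : \bar R :=
  if z.1 \in S then
    if z.2 then Psi B else ((1 - delta)^-1)%:E * (P z.1 B - delta%:E * Psi B)
  else P z.1 B.

(* Given the past, X_{n+1} ~ split_fst Z_n and Y_{n+1} ~ Bernoulli(delta) are
   independent; [ysection W b] is the set of the x such that (x, b) \in W. *)
Definition split_kernel (S : set E) (delta : R) (Psi : probability E R)
    (z : E * bool) (W : set (E * bool)) : \bar R :=
  delta%:E * split_fst S delta Psi z (ysection W true) +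
  (1 - delta)%:E * split_fst S delta Psi z (ysection W false).

Definition atom (S : set E) : set (E * bool) := S `*` [set true].

(* The initial law is any law carried by the atom. *)
Definition split_chain_from_atom (S : set E) (delta : R) (Psi : probability E R)
    dO (Om : measurableType dO) (PA : probability Om R)
    (Z : nat -> {mfun Om >-> (E * bool)%type}) : Prop :=
  PA (Z 0%N @^-1` atom S) = 1 /\
  markov_property (split_kernel S delta Psi) PA Z.

End Kernel.

Section Blocks.
Context d (E : measurableType d) dO (Om : measurableType dO).
Context (S : set E) (Z : nat -> {mfun Om >-> (E * bool)%type}).

Definition regen_time (j : nat) : Om -> \bar R := entrance_time Z (atom S) j.

(* sum of f(X_i) over s < i <= t; it is a genuine finite sum if t < +oo *)
Definition sum_between (s t : \bar R) (f : E -> R) (w : Om) : R :=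
  (\sum_(i \in [set i : nat | (s < i%:R%:E <= t)%E]) f (Z i w).1)%R.

Definition cycle_sum (f : E -> R) (w : Om) : R :=
  sum_between 0 (regen_time 1 w) f w.

Definition block_sum (f : E -> R) (k : nat) (w : Om) : R :=
  sum_between (regen_time k w) (regen_time k.+1 w) f w.

(* the block B_k has length l and its j-th entry lies in C *)
Definition block_event (k l j : nat) (C : set E) : set Om :=
  [set w | exists t : nat, [/\ regen_time k w = t%:R%:E,
     regen_time k.+1 w = (t + l)%:R%:E & C (Z (t + j)%N w).1]].

Definition sigma_blocks : set (set Om) :=
  <<s [set G | exists k l j C, [/\ (1 <= k)%N, (1 <= j <= l)%N, measurable C &
                                   G = block_event k l j C]] >>.

Definition rademacher_indep_of_blocks (PA : probability Om R)
    (eps : nat -> {mfun Om >-> R}) : Prop :=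
  [/\ forall k, PA (eps k @^-1` [set 1%R]) = (2^-1)%:E,
      forall k, PA (eps k @^-1` [set (-1)%R]) = (2^-1)%:E,
      mutually_independent PA
        (fun k => preimage_set_system setT (eps k) measurable) &
      independent PA (sigma_of (fun k => eps k : Om -> R) setT) sigma_blocks].

Definition block_rademacher (PA : probability Om R)
    (eps : nat -> {mfun Om >-> R}) (n : nat) (F : set (E -> R)) : \bar R :=
  \int[PA]_w ereal_sup
    [set `| \sum_(1 <= k < n.+1) eps k w * block_sum f k w |%R%:E | f in F].

End Blocks.

End MarkovChains.

Section VCType.
Context (R : realType) d (E : measurableType d).
Local Open Scope ereal_scope.

Definition L2norm (Q : probability E R) (f : E -> R) : \bar R :=
  Lnorm Q 2%:E (EFin \o f).

(* The centres of the balls need not belong to F. *)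
Definition covered_by (r : \bar R) (F : set (E -> R)) (Q : probability E R)
    (N : nat) : Prop :=
  exists c : 'I_N -> E -> R,
    (forall i, measurable_fun setT (c i) /\ L2norm Q (c i) < +oo) /\
    forall f, F f -> exists i, L2norm Q (f \- c i)%R < r.

Definition covering_number (r : \bar R) (F : set (E -> R)) (Q : probability E R)
    : \bar R :=
  ereal_inf [set N%:R%:E | N in covered_by r F Q].

Definition vc_type (F : set (E -> R)) (env : E -> R) (C v : R) : Prop :=
  [/\ countable F,
      forall f, F f -> measurable_fun setT f /\ forall x, (`|f x| <= env x)%R,
      (1 <= v)%R, ((3 * Num.sqrt (expR 1)) `^ v <= C)%R &
      forall (Q : probability E R) (e : R),
        0 < L2norm Q env < +oo -> (0 < e < 1)%R ->
        covering_number (e%:E * L2norm Q env) F Q <= (C * e `^ (- v))%:E].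

End VCType.

(* Main.v *)
(* The blocks of the split chain are i.i.d. because the chain regenerates at its visits to
   the atom.  Blocks longer than L are replaced by empty ones: this costs at most U times
   the total length of the long blocks, whose expectation is controlled by the moment of
   tau_A.  The sums f'(B) over the remaining blocks are bounded by L U, and by
   Cauchy-Schwarz an L2 cover of F for the empirical measure of all the points in n such
   blocks covers the vectors (f'(B_1), ..., f'(B_n)).  Chaining then bounds the conditional
   Rademacher average by sqrt(D v log(C L U / sigma')), up to a constant, with
   D = n sigma'^2 + sup_f sum_k f'(B_k)^2; symmetrization and the same chaining bound,
   applied to the squares, give E D <= c n sigma'^2 + c' L U sqrt(v log(...)) sqrt(E D),
   which is solved for E D.  As F is countable, finite subclasses suffice, and rounding the
   finitely many block sums to a mesh reduces the estimate to samples from a finite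
   probability space. *)
Require Import Defs.
From HB Require Import structures.
From mathcomp Require Import all_boot all_order all_algebra finmap.
From mathcomp Require Import all_classical all_reals all_analysis.
From mathcomp Require Import measurable_realfun ring lra zify.
Import Order.TTheory GRing.Theory Num.Theory.
Import numFieldNormedType.Exports.
Local Open Scope classical_set_scope.
Local Open Scope ring_scope.

Set Implicit Arguments.
Unset Strict Implicit.
Unset Printing Implicit Defensive.

(** * Rademacher averages of finite sets *)

(** The split kernel is only a set function, so no conditional law of the whole future is at hand:
    regeneration is derived from the one-step Markov property on cylinders and extended by
    uniqueness of finite measures on a pi-system. Several comparisons of integrals let one side be
    an arbitrary nonnegative function, because the supremum in the Rademacher average, the squared
    cycle sum and the moment function of [tau_A] come without a measurability proof. Emptying a long
    block instead of discarding it keeps exactly [n] i.i.d. terms. On a finite probability space the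
    ghost sample, the exchange of coordinates and the conditioning are rearrangements of finite
    sums; the rounding error [n * eta] is sent to 0 only at the end. For the squares, a cover of the
    functions is turned into a cover of their squares by clipping its centres to [[-V, V]], where
    squaring is [2 * V]-Lipschitz; this replaces the contraction principle. *)

Section Rademacher.
Context {R : realType}.

(** The sharp exponent is [x ^+ 2 / 2]; with the weaker [2 * x ^+ 2] the inequality
    [1 + y <= expR y] suffices. For [|x| < 1], squaring [1 - y / 2 <= expR (- (y / 2))] bounds
    [expR y] by [(1 - y / 2) ^- 2] at [y = x] and [y = - x]; for [|x| >= 1] simply
    [|x| <= 2 * x ^+ 2]. *)
Lemma cosh_le (x : R) : expR x + expR (- x) <= 2 * expR (2 * x ^+ 2).
Proof.
have [x1|x1] := ltrP `|x| 1; last first.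
  have h (y : R) : `|y| = `|x| -> expR y <= expR (2 * x ^+ 2).
    move=> yx; rewrite ler_expR (le_trans (ler_norm _))// yx.
    by rewrite -(real_normK (num_real x)); nra.
  by have := h x erefl; have := h (- x) (normrN x); lra.
have h (y : R) : `|y| < 1 -> expR y * (1 - y / 2) ^+ 2 <= 1.
  move=> y1.
  have e0 := expR_ge1Dx (- (y / 2)).
  have y2 : 0 <= 1 - y / 2 by have := ler_norm y; lra.
  have -> : y = y / 2 + y / 2 by field.
  rewrite expRD; have := expRxMexpNx_1 (y / 2).
  have := expR_gt0 (y / 2); set a := expR (y/2); set b := expR (- _) in e0 *.
  move=> a0 ab.
  have -> : 1 - (y / 2 + y / 2) / 2 = 1 - y / 2 by field.
  have : a * (1 - y / 2) <= a * b by rewrite ler_wpM2l// ltW.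
  rewrite ab.
  have : 0 <= a * (1 - y / 2) by rewrite mulr_ge0// ltW.
  set c := a * _ => c0 c1.
  have -> : a * a * (1 - y / 2) ^+ 2 = c * c by rewrite /c; ring.
  nra.
have h1 := h x x1.
have := h (- x); rewrite normrN => /(_ x1) h2.
have e3 := expR_ge1Dx (2 * x ^+ 2).
set a := expR x in h1 *; set b := expR (- x) in h2 *.
have x2 : x ^+ 2 < 1 by rewrite -real_normK ?num_real//; have := normr_ge0 x; nra.
have x0 : 0 <= x ^+ 2 by exact: sqr_ge0.
apply: (@le_trans _ _ (2 * (1 + 2 * x ^+ 2))); last by lra.
set u := x ^+ 2 in x0 x2 *.
have P0 : 0 < (1 - u / 4) ^+ 2 by rewrite exprn_gt0//; lra.
rewrite -(ler_pM2r P0).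
have -> : (1 - u / 4) ^+ 2 = (1 - x / 2) ^+ 2 * (1 + x / 2) ^+ 2 by rewrite /u; field.
rewrite mulrDl.
have -> : a * ((1 - x / 2) ^+ 2 * (1 + x / 2) ^+ 2) = (a * (1 - x / 2) ^+ 2) * (1 + x / 2) ^+ 2 by ring.
have -> : b * ((1 - x / 2) ^+ 2 * (1 + x / 2) ^+ 2) = (b * (1 - (- x) / 2) ^+ 2) * (1 - x / 2) ^+ 2 by field.
apply: (@le_trans _ _ ((1 + x / 2) ^+ 2 + (1 - x / 2) ^+ 2)).
  by apply: lerD; rewrite ler_piMl// sqr_ge0.
have -> : (1 + x / 2) ^+ 2 + (1 - x / 2) ^+ 2 = 2 * (1 + u / 4) by rewrite /u; field.
have -> : 2 * (1 + 2 * u) * ((1 - x / 2) ^+ 2 * (1 + x / 2) ^+ 2) = 2 * (1 + 2 * u) * (1 - u / 4) ^+ 2 by rewrite /u; field.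
nra.
Qed.

Definition sign (b : bool) : R := (-1) ^+ b.

Lemma normr_sign b : `|sign b| = 1.
Proof. by rewrite /sign normrX normrN1 expr1n. Qed.

Definition radmean {n} (h : {ffun 'I_n -> bool} -> R) : R :=
  (2 ^+ n)^-1 * \sum_s h s.

Definition radsum {n} (s : {ffun 'I_n -> bool}) (t : 'I_n -> R) : R :=
  \sum_k sign (s k) * t k.

Definition maxabs {I : finType} (a : I -> R) : R := \big[Num.max/0]_j `|a j|.

Lemma radmean_le n (g h : {ffun 'I_n -> bool} -> R) :
  (forall s, g s <= h s) -> radmean g <= radmean h.
Proof.
by move=> gh; rewrite ler_pM2l ?invr_gt0 ?exprn_gt0//; apply: ler_sum.
Qed.

Lemma radmeanD n (g h : {ffun 'I_n -> bool} -> R) :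
  radmean (fun s => g s + h s) = radmean g + radmean h.
Proof. by rewrite /radmean big_split mulrDr. Qed.

Lemma radmeanZ n c (h : {ffun 'I_n -> bool} -> R) :
  radmean (fun s => c * h s) = c * radmean h.
Proof. by rewrite /radmean -mulr_sumr mulrCA. Qed.

Lemma radmean_sum n I (r : seq I) (h : I -> {ffun 'I_n -> bool} -> R) :
  radmean (fun s => \sum_(i <- r) h i s) = \sum_(i <- r) radmean (h i).
Proof. by rewrite /radmean exchange_big mulr_sumr. Qed.

Lemma radmean_cst n c : radmean (fun _ : {ffun 'I_n -> bool} => c) = c.
Proof.
rewrite /radmean sumr_const card_ffun card_bool card_ord -[c *+ _]mulr_natl natrX.
by rewrite mulKf// expf_neq0.
Qed.

(** Hoeffding's estimate: the mean over all sign vectors of a product of coordinatewise factors is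
    the product of their means, and each mean is a hyperbolic cosine. *)
Lemma radmean_expR n (a : 'I_n -> R) l :
  radmean (fun s => expR (l * radsum s a))
    <= expR (2 * l ^+ 2 * \sum_k a k ^+ 2).
Proof.
have -> : radmean (fun s => expR (l * radsum s a)) =
    \prod_k ((expR (l * a k) + expR (- (l * a k))) / 2).
  rewrite big_split /= prodr_const card_ord mulrC /radmean -exprVn; congr (_ * _).
  transitivity (\sum_(s : {ffun 'I_n -> bool}) \prod_k expR (l * (sign (s k) * a k))).
    by apply: eq_bigr => s _; rewrite /radsum mulr_sumr expR_sum.
  rewrite -(bigA_distr_bigA (fun k b => expR (l * (sign b * a k)))).
  apply: eq_bigr => k _.
  by rewrite big_bool/= /sign expr1 expr0 mulN1r mul1r mulrN addrC.
rewrite mulr_sumr expR_sum; apply: ler_prod => k _.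
rewrite divr_ge0 ?addr_ge0 ?expR_ge0//= ler_pdivrMr//.
rewrite (_ : 2 * l ^+ 2 * a k ^+ 2 = 2 * (l * a k) ^+ 2); last by ring.
by rewrite [leRHS]mulrC cosh_le.
Qed.

Lemma ler_maxabs (I : finType) (a : I -> R) j : `|a j| <= maxabs a.
Proof. by rewrite /maxabs (bigD1 j)//= le_max lexx. Qed.

Lemma maxabs_ge0 (I : finType) (a : I -> R) : 0 <= maxabs a.
Proof. by rewrite /maxabs; elim/big_ind : _ => // x y x0 y0; rewrite le_max x0. Qed.

Lemma maxabs_le (I : finType) (a : I -> R) (c : R) :
  0 <= c -> (forall j, `|a j| <= c) -> maxabs a <= c.
Proof.
move=> c0 ac; rewrite /maxabs; elim/big_ind : _ => // x y xc yc.
by rewrite ge_max xc.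
Qed.

Lemma maxabsD (I : finType) (a b : I -> R) :
  maxabs (fun j => a j + b j) <= maxabs a + maxabs b.
Proof.
apply: maxabs_le => [|j]; first by rewrite addr_ge0 ?maxabs_ge0.
by rewrite (le_trans (ler_normD _ _))// lerD ?ler_maxabs.
Qed.

(* Convexity of exp without Jensen: [x <= a + (expR (x - a) - 1)]. *)
Lemma radmean_maxabs_le n (I : finType) (a : I -> 'I_n -> R) d y :
  0 < d -> 1 <= y -> #|I|%:R <= expR y ->
  (forall i, \sum_k a i k ^+ 2 <= d ^+ 2) ->
  radmean (fun s => maxabs (fun i : I => radsum s (a i))) <= 5 * d * Num.sqrt y.
Proof.
move=> d0 y1 Ny ad.
set w := Num.sqrt y.
have w1 : 1 <= w by rewrite -[1]sqrtr1 ler_wsqrtr.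
have w2 : w ^+ 2 = y by rewrite sqr_sqrtr//; lra.
(* This [l] turns the moment exponent [2 * (l * d) ^+ 2] into [2 * y]. Together with the entropy [y]
   it makes [A = 3 * y], so that [expR (- A)] cancels the sum of exponentials up to a factor 2. *)
pose l := w / d.
have l0 : 0 < l by rewrite divr_gt0//; lra.
have ln0 : l != 0 by rewrite gt_eqF.
pose A := 3 * y.
have key s : maxabs (fun i : I => radsum s (a i)) <= l^-1 * (A - 1 + expR (- A) *
    (1 + \sum_i (expR (l * radsum s (a i)) + expR (- l * radsum s (a i))))).
  set T := \sum_i _.
  have T0 : 0 <= T by apply: sumr_ge0 => i _; rewrite addr_ge0 ?expR_ge0.
  have E c : expR c <= 1 + T -> c <= A - 1 + expR (- A) * (1 + T).
    move=> cT; have := expR_ge1Dx (c - A); rewrite expRD => h.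
    have : expR c * expR (- A) <= (1 + T) * expR (- A) by rewrite ler_pM2r ?expR_gt0.
    lra.
  rewrite ler_pdivlMl//; rewrite /maxabs.
  apply: E.
  apply: (big_ind (fun x => expR (l * x) <= 1 + T)).
  - by rewrite mulr0 expR0; lra.
  - by move=> x z hx hz; rewrite /Num.max; case: ifP.
  - move=> i _.
    have : expR (l * radsum s (a i)) + expR (- l * radsum s (a i)) <= T.
      by rewrite /T (bigD1 i)//= lerDl sumr_ge0// => k _; rewrite addr_ge0 ?expR_ge0.
    have := expR_gt0 (l * radsum s (a i)); have := expR_gt0 (- l * radsum s (a i)).
    by case: (ger0P (radsum s (a i))) => _; rewrite ?mulrN -?mulNr; lra.
apply: le_trans (radmean_le key) _.
rewrite radmeanZ radmeanD radmean_cst radmeanZ radmeanD radmean_cst radmean_sum.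
have S i : radmean (fun s => expR (l * radsum s (a i)) + expR (- l * radsum s (a i))) <= 2 * expR (2 * y).
  rewrite radmeanD.
  have h c : c ^+ 2 = l ^+ 2 -> radmean (fun s => expR (c * radsum s (a i))) <= expR (2 * y).
    move=> cl; apply: le_trans (radmean_expR _ _) _.
    rewrite ler_expR cl /l -mulrA ler_pM2l// -w2 exprMn exprVn -mulrA.
    by rewrite ler_piMr ?sqr_ge0// mulrC ler_pdivrMr ?mul1r ?exprn_gt0.
  by have := h l erefl; have := h (- l) (sqrrN l); lra.
apply: (@le_trans _ _ (l^-1 * (A - 1 + expR (- A) * (1 + #|I|%:R * (2 * expR (2 * y)))))).
  rewrite ler_pM2l ?invr_gt0// lerD2l ler_pM2l ?expR_gt0// lerD2l.
  have -> : #|I|%:R * (2 * expR (2 * y)) = \sum_(i : I) (2 * expR (2 * y)).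
    by rewrite sumr_const mulr_natl.
  exact: ler_sum.
have e1 : expR (- A) <= 1 by rewrite -[1]expR0 ler_expR /A; lra.
have e2 : expR (- A) * (#|I|%:R * (2 * expR (2 * y))) <= 2.
  apply: (@le_trans _ _ (expR (- A) * (expR y * (2 * expR (2 * y))))).
    by rewrite ler_pM2l ?expR_gt0// ler_pM2r// mulr_gt0 ?expR_gt0.
  have -> : expR (- A) * (expR y * (2 * expR (2 * y))) = 2 * (expR (- A) * (expR y * expR (2 * y))) by ring.
  rewrite -!expRD (_ : - A + _ = 0) ?expR0 ?mulr1// /A; ring.
have -> : 5 * d * w = l^-1 * (5 * y) by rewrite /l -w2 invf_div; field; lra.
rewrite ler_pM2l ?invr_gt0// /A in e1 e2 *; rewrite mulrDr mulr1; lra.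
Qed.


Lemma sumr_sqr_normr_le n (a : 'I_n -> R) d k :
  0 <= d -> \sum_k a k ^+ 2 <= d ^+ 2 -> `|a k| <= d.
Proof.
move=> d0 ad; rewrite -(ger0_norm d0) -ler_sqr ?nnegrE ?normr_ge0// !real_normK ?num_real//.
by apply: le_trans ad; rewrite (bigD1 k)//= lerDl sumr_ge0// => i _; rewrite sqr_ge0.
Qed.

Lemma normr_radsum_le n s (a : 'I_n -> R) c :
  (forall k, `|a k| <= c) -> `|radsum s a| <= n%:R * c.
Proof.
move=> ac; apply: le_trans (ler_norm_sum _ _ _) _.
rewrite -[n in n%:R]card_ord -sum1_card natr_sum mulr_suml; apply: ler_sum => k _.
by rewrite normrM normr_sign !mul1r.
Qed.

Lemma radsumD n s (a b : 'I_n -> R) :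
  radsum s (fun k => a k + b k) = radsum s a + radsum s b.
Proof. by rewrite /radsum -big_split; apply: eq_bigr => k _; rewrite mulrDr. Qed.

Lemma le_of_pow2 (a b c : R) : (forall q : nat, a <= b + c / 2 ^+ q) -> a <= b.
Proof.
move=> h; apply/ler_addgt0Pr => e e0.
have [c0|c0] := lerP c 0.
  by have := h 0; rewrite expr0 divr1; lra.
pose q := (Num.truncn (c / e)).+1.
apply: le_trans (h q) _; rewrite lerD2l ler_pdivrMr ?exprn_gt0//.
rewrite mulrC -ler_pdivrMr//.
have : c / e < q%:R by rewrite truncnS_gt.
move/ltW/le_trans; apply.
by rewrite -natrX ler_nat ltnW// ltn_expl.
Qed.

(** A discrete Dudley bound: [t j] is telescoped along centres at the scales [r / 2 ^+ q]. The links
    of level [q] have norm at most [2 * r / 2 ^+ q] and cost [10 * r * sqrt B * (2 q + 1) / 2 ^+ q];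
    the weights [(2 q + 1) / 2 ^+ q] sum to at most 6, whence 60. *)
Lemma chaining n m (t : 'I_m -> 'I_n -> R) r B :
  0 < r -> 1 <= B ->
  (forall j, \sum_k t j k ^+ 2 <= r ^+ 2) ->
  (forall q, (0 < q)%N -> exists N (c : 'I_N -> 'I_n -> R),
     N%:R <= expR (q%:R * B) /\
     forall j, exists i, \sum_k (t j k - c i k) ^+ 2 <= (r / 2 ^+ q) ^+ 2) ->
  radmean (fun s => maxabs (fun j => radsum s (t j))) <= 60 * r * Num.sqrt B.
Proof.
move=> r0 B1 tr cov.
have {}cov q : exists x : {N & 'I_N -> 'I_n -> R},
    [/\ (tag x)%:R <= expR (q%:R * B),
    forall j, exists i, \sum_k (t j k - tagged x i k) ^+ 2 <= (r / 2 ^+ q) ^+ 2 &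
    q = 0 -> forall i k, tagged x i k = 0].
  case: q => [|q]; last by have [N [c [h1 h2]]] := cov q.+1 isT; exists (existT _ N c).
  (* At level 0 the origin alone is a cover, since [r] bounds all the norms and [expR 0 = 1]. *)
  exists (existT _ 1%N (fun _ _ => 0)); rewrite mul0r expR0; split => //= j.
  exists ord0; rewrite expr0 divr1.
  by under eq_bigr do rewrite subr0.
have {cov} /choice[C CP] := cov.
have nrst q j : exists i, \sum_k (t j k - tagged (C q) i k) ^+ 2 <= (r / 2 ^+ q) ^+ 2.
  by have [_ + _] := CP q; apply.
pose p q j := tagged (C q) (projT1 (cid (nrst q j))).
have pP q j : \sum_k (t j k - p q j k) ^+ 2 <= (r / 2 ^+ q) ^+ 2.
  exact: projT2 (cid (nrst q j)).
pose lk q s := maxabs (fun j => radsum s (fun k => p q.+1 j k - p q j k)).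
have pow0 q : 0 < 2 ^+ q :> R by rewrite exprn_gt0.
(* The links of level [q] take at most [expR ((2 q + 1) B)] values, which is why the
   cover may grow exponentially in [q]. *)
have link q : radmean (lk q) <= 10 * r * Num.sqrt B * ((2 * q%:R + 1) / 2 ^+ q).
  pose I : finType := ('I_(tag (C q)) * 'I_(tag (C q.+1)))%type.
  pose d := 2 * (r / 2 ^+ q).
  have d0 : 0 < d by rewrite mulr_gt0// divr_gt0.
  pose b (i : I) k := tagged (C q.+1) i.2 k - tagged (C q) i.1 k.
  (* Pairs of centres that lie too far apart are replaced by 0, so that every pair meets the norm
     bound; no pair that occurs as a link is affected. *)
  pose a (i : I) := if \sum_k b i k ^+ 2 <= d ^+ 2 then b i else fun=> 0.
  have q1 : 1 <= 2 * q%:R + 1 :> R by have := ler0n R q; lra.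
  have Y1 : 1 <= (2 * q%:R + 1) * B by nra.
  have IN : #|{: I}|%:R <= expR ((2 * q%:R + 1) * B).
    rewrite card_prod !card_ord natrM.
    rewrite (_ : _ * B = q%:R * B + q.+1%:R * B) ?expRD; last by rewrite -natr1; ring.
    by apply: ler_pM => //; have [] := CP q; have [] := CP q.+1.
  have ad i : \sum_k a i k ^+ 2 <= d ^+ 2.
    rewrite /a; case: ifP => // _.
    by rewrite big1 ?sqr_ge0// => k _; rewrite expr0n.
  have := radmean_maxabs_le d0 Y1 IN ad; move=> h.
  apply: le_trans (_ : _ <= radmean (fun s => maxabs (fun i : I => radsum s (a i)))) _.
    apply: radmean_le => s; apply: maxabs_le => [|j]; first exact: maxabs_ge0.
    pose i : I := (projT1 (cid (nrst q j)), projT1 (cid (nrst q.+1 j))).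
    have -> : radsum s (fun k => p q.+1 j k - p q j k) = radsum s (a i).
      rewrite /a /= ifT//.
      have h1 := pP q j; have h2 := pP q.+1 j.
      apply: (@le_trans _ _ (\sum_k (2 * (t j k - p q j k) ^+ 2 + 2 * (t j k - p q.+1 j k) ^+ 2))).
        have E (x y z : R) : (z - y) ^+ 2 <= 2 * (x - y) ^+ 2 + 2 * (x - z) ^+ 2.
          rewrite -subr_ge0.
          rewrite (_ : _ - _ = (x - y + (x - z)) ^+ 2) ?sqr_ge0//; ring.
        by apply: ler_sum => k _; exact: E.
      rewrite big_split/= -!mulr_sumr /d.
      have : (r / 2 ^+ q.+1) ^+ 2 <= (r / 2 ^+ q) ^+ 2.
        rewrite ler_sqr ?nnegrE ?divr_ge0 ?(ltW r0) ?exprn_ge0//.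
        by rewrite ler_pM2l// lef_pV2 ?posrE// exprS; have := pow0 q; lra.
      nra.
    exact: ler_maxabs.
  apply: le_trans h _; rewrite /d sqrtrM; last lra.
  have -> : 5 * (2 * (r / 2 ^+ q)) * (Num.sqrt (2 * q%:R + 1) * Num.sqrt B) = 10 * r * Num.sqrt B * (Num.sqrt (2 * q%:R + 1) / 2 ^+ q) by field; rewrite gt_eqF.
  rewrite ler_wpM2l ?mulr_ge0 ?sqrtr_ge0//; first lra.
  rewrite ler_pM2r ?invr_gt0//.
  have u0 := sqrtr_ge0 (2 * q%:R + 1 : R).
  have u2 : Num.sqrt (2 * q%:R + 1) ^+ 2 = 2 * q%:R + 1 :> R by rewrite sqr_sqrtr//; lra.
  nra.
(* After [Q] levels the remainder is at most [n * r / 2 ^+ Q] by the trivial bound on a signed sum;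
   it vanishes as [Q] grows. *)
apply: (@le_of_pow2 _ _ (n%:R * r)) => Q.
have geo : \sum_(q < Q) ((2 * q%:R + 1) / 2 ^+ q) <= 6 - (4 * Q%:R + 6) / 2 ^+ Q :> R.
  elim: Q => [|Q IH]; first by rewrite big_ord0 expr0; lra.
  rewrite big_ord_recr/=.
  have -> : 6 - (4 * Q.+1%:R + 6) / 2 ^+ Q.+1 = 6 - (4 * Q%:R + 6) / 2 ^+ Q + (2 * Q%:R + 1) / 2 ^+ Q :> R.
    by rewrite exprS -natr1; field; rewrite gt_eqF.
  by rewrite lerD2r.
apply: (@le_trans _ _ (\sum_(q < Q) radmean (lk q) + n%:R * r / 2 ^+ Q)); last first.
  rewrite lerD2r.
  apply: (@le_trans _ _ (\sum_(q < Q) 10 * r * Num.sqrt B * ((2 * q%:R + 1) / 2 ^+ q))).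
    exact: ler_sum.
  rewrite -mulr_sumr.
  have -> : 60 * r * Num.sqrt B = 10 * r * Num.sqrt B * 6 by ring.
  rewrite ler_wpM2l ?mulr_ge0 ?sqrtr_ge0//; first lra.
  apply: le_trans geo _; rewrite lerBlDr lerDl divr_ge0 ?(ltW (pow0 _))//.
rewrite -radmean_sum -(radmean_cst n (n%:R * r / 2 ^+ Q)) -radmeanD.
apply: radmean_le => s; apply: maxabs_le => [|j].
  rewrite addr_ge0//; first by apply: sumr_ge0 => q _; exact: maxabs_ge0.
  by rewrite divr_ge0 ?mulr_ge0 ?(ltW r0) ?(ltW (pow0 _)).
have tel : radsum s (t j) = \sum_(q < Q) radsum s (fun k => p q.+1 j k - p q j k) +
    radsum s (fun k => t j k - p Q j k) + radsum s (p 0 j).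
  elim: Q {geo} => [|Q IH].
    by rewrite big_ord0 add0r -radsumD; apply: eq_bigr => k _; rewrite subrK.
  rewrite big_ord_recr/= {}IH; congr (_ + _); rewrite -addrA; congr (_ + _).
  by rewrite -radsumD; apply: eq_bigr => k _; congr (_ * _); ring.
rewrite tel [radsum s (p _ _)]big1 ?addr0; last first.
  by move=> k _; have [_ _ /(_ erefl) p0] := CP 0; rewrite /p p0 mulr0.
apply: le_trans (ler_normD _ _) _; apply: lerD.
  apply: le_trans (ler_norm_sum _ _ _) _; apply: ler_sum => q _.
  exact: ler_maxabs.
rewrite -mulrA; apply: normr_radsum_le => k.
by apply: (sumr_sqr_normr_le (a := fun k => t j k - p Q j k)) (pP Q j); rewrite divr_ge0 ?(ltW r0) ?(ltW (pow0 _)).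
Qed.

End Rademacher.

(** * Samples from a finite probability space *)

Section FiniteSample.
Context {R : realType} {X : finType} (p : X -> R).

Definition sample_mean {n} (h : {ffun 'I_n -> X} -> R) : R :=
  \sum_(x : {ffun 'I_n -> X}) (\prod_k p (x k)) * h x.

Hypothesis p_ge0 : forall x, 0 <= p x.
Hypothesis p_sum1 : \sum_x p x = 1.

Lemma sample_mean_le n (g h : {ffun 'I_n -> X} -> R) :
  (forall x, g x <= h x) -> sample_mean g <= sample_mean h.
Proof.
by move=> gh; apply: ler_sum => x _; rewrite ler_wpM2l// prodr_ge0.
Qed.

Lemma sample_mean_ge0 n (h : {ffun 'I_n -> X} -> R) :
  (forall x, 0 <= h x) -> 0 <= sample_mean h.
Proof. by move=> h0; apply: sumr_ge0 => x _; rewrite mulr_ge0 ?prodr_ge0. Qed.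

Lemma sample_meanD n (g h : {ffun 'I_n -> X} -> R) :
  sample_mean (fun x => g x + h x) = sample_mean g + sample_mean h.
Proof. by rewrite /sample_mean -big_split; apply: eq_bigr => x _; rewrite mulrDr. Qed.

Lemma sample_meanZ n c (h : {ffun 'I_n -> X} -> R) :
  sample_mean (fun x => c * h x) = c * sample_mean h.
Proof. by rewrite /sample_mean mulr_sumr; apply: eq_bigr => x _; rewrite mulrCA. Qed.

Lemma sample_mean_sum n I (r : seq I) (h : I -> {ffun 'I_n -> X} -> R) :
  sample_mean (fun x => \sum_(i <- r) h i x) = \sum_(i <- r) sample_mean (h i).
Proof. by rewrite /sample_mean exchange_big; apply: eq_bigr => x _; rewrite mulr_sumr. Qed.

Lemma sample_mean_coord n (k : 'I_n) (h : X -> R) :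
  sample_mean (fun x => h (x k)) = \sum_u p u * h u.
Proof.
transitivity (\sum_(x : {ffun 'I_n -> X}) \prod_i (p (x i) * (if i == k then h (x i) else 1))).
  apply: eq_bigr => x _; rewrite big_split/=; congr (_ * _).
  by rewrite -big_mkcond/= big_pred1_eq.
rewrite -(bigA_distr_bigA (fun i u => p u * (if i == k then h u else 1))).
rewrite (bigD1 k)//= eqxx [X in _ * X]big1 ?mulr1// => i /negPf ->.
by under eq_bigr do rewrite mulr1.
Qed.

Lemma sample_mean1 n : sample_mean (fun _ : {ffun 'I_n -> X} => 1) = 1.
Proof.
rewrite /sample_mean; under eq_bigr do rewrite mulr1.
rewrite -(bigA_distr_bigA (fun _ => p)).
by rewrite big1.
Qed.

Lemma sample_mean_cst n c : sample_mean (fun _ : {ffun 'I_n -> X} => c) = c.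
Proof. by rewrite -[c]mulr1 sample_meanZ sample_mean1. Qed.

(** Jensen's inequality, from the nonnegativity of the variance of [Num.sqrt (h x)]. *)
Lemma sample_mean_sqrt n (h : {ffun 'I_n -> X} -> R) :
  (forall x, 0 <= h x) ->
  sample_mean (fun x => Num.sqrt (h x)) <= Num.sqrt (sample_mean h).
Proof.
move=> h0; set a := sample_mean _.
have a0 : 0 <= a by apply: sample_mean_ge0 => x; exact: sqrtr_ge0.
rewrite -[a]ger0_norm// -sqrtr_sqr ler_wsqrtr//.
have V0 : 0 <= sample_mean (fun x => (Num.sqrt (h x) - a) ^+ 2).
  by apply: sample_mean_ge0 => x; exact: sqr_ge0.
have := V0.
have -> : sample_mean (fun x => (Num.sqrt (h x) - a) ^+ 2) =
    sample_mean (fun x => h x + (- 2 * a * Num.sqrt (h x) + a ^+ 2)).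
  by apply: eq_bigr => x _; rewrite sqrrB sqr_sqrtr//; ring.
rewrite !sample_meanD sample_meanZ sample_mean_cst -/a; lra.
Qed.

(** Exchanging a sample with its ghost copy at the coordinates selected by [b] is an involution that
    preserves the product weights. *)
Lemma sample_mean_swap n (b : bool ^ n) (h : {ffun 'I_n -> X} -> {ffun 'I_n -> X} -> R) :
  sample_mean (fun x => sample_mean (h x)) =
  sample_mean (fun x => sample_mean (fun y =>
    h [ffun k => if b k then y k else x k] [ffun k => if b k then x k else y k])).
Proof.
pose w (z : {ffun 'I_n -> X} * {ffun 'I_n -> X}) :=
  (\prod_k p (z.1 k)) * (\prod_k p (z.2 k)).
pose phi (z : {ffun 'I_n -> X} * {ffun 'I_n -> X}) :=
  ([ffun k => if b k then z.2 k else z.1 k], [ffun k => if b k then z.1 k else z.2 k]).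
have E (f : {ffun 'I_n -> X} -> {ffun 'I_n -> X} -> R) :
    sample_mean (fun x => sample_mean (f x)) = \sum_z w z * f z.1 z.2.
  rewrite -(pair_bigA _ (fun x y => w (x, y) * f x y))/=.
  by apply: eq_bigr => x _; rewrite mulr_sumr; apply: eq_bigr => y _; rewrite mulrA.
rewrite !E (reindex_inj (inv_inj (f := phi) _))/=.
  apply: eq_bigr => z _; congr (_ * _); rewrite /w -!big_split/=.
  by apply: eq_bigr => k _; rewrite !ffunE; case: (b k) => //; rewrite mulrC.
move=> [x y]; rewrite /phi/=; congr pair; apply/ffunP => k; rewrite !ffunE;
  by case: (b k).
Qed.

Variables (n m : nat) (g : 'I_m -> X -> R) (V s B : R).
Hypothesis n_gt0 : (0 < n)%N.
Hypothesis s_gt0 : 0 < s.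
Hypothesis B_ge1 : 1 <= B.
Hypothesis V_gt0 : 0 < V.
Hypothesis g_le : forall j u, `|g j u| <= V.
(** The factor 2 leaves room for rounding: the block sums themselves have second moment at most
    [s ^+ 2], and the mesh is at most [s]. *)
Hypothesis g_sqr : forall j, \sum_u p u * g j u ^+ 2 <= (2 * s) ^+ 2.
Hypothesis g_cover : forall (x : {ffun 'I_n -> X}) q, (0 < q)%N ->
  exists N (c : 'I_N -> 'I_n -> R), N%:R <= expR (q%:R * B) /\
    forall j, exists i, \sum_k (g j (x k) - c i k) ^+ 2 <=
                        (Num.sqrt n%:R * s / 2 ^+ q) ^+ 2.

Let sup_sqr (x : {ffun 'I_n -> X}) : R := maxabs (fun j => \sum_k g j (x k) ^+ 2).
(* The [n s^2] term makes the radius at least the scale of the covers. *)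
Let rad (x : {ffun 'I_n -> X}) := Num.sqrt (sup_sqr x + n%:R * s ^+ 2).

Let sn_gt0 : 0 < Num.sqrt n%:R * s.
Proof. by rewrite mulr_gt0// sqrtr_gt0 ltr0n. Qed.

Let sn_sqr : (Num.sqrt n%:R * s) ^+ 2 = n%:R * s ^+ 2.
Proof. by rewrite exprMn sqr_sqrtr. Qed.

Let rad_sqr x : rad x ^+ 2 = sup_sqr x + n%:R * s ^+ 2.
Proof. by rewrite sqr_sqrtr// addr_ge0 ?maxabs_ge0// mulr_ge0 ?sqr_ge0. Qed.

Let sn_le_rad x : Num.sqrt n%:R * s <= rad x.
Proof.
rewrite -ler_sqr ?nnegrE ?sqrtr_ge0 ?(ltW sn_gt0)// rad_sqr sn_sqr.
by rewrite lerDr maxabs_ge0.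
Qed.

Let rad_gt0 x : 0 < rad x.
Proof. exact: lt_le_trans (sn_le_rad x). Qed.

Let sqr_le_rad (x : {ffun 'I_n -> X}) j : \sum_k g j (x k) ^+ 2 <= rad x ^+ 2.
Proof.
rewrite rad_sqr; apply: le_trans (ler_norm _) _.
apply: le_trans (ler_maxabs (fun j => \sum_k g j (x k) ^+ 2) j) _.
by rewrite lerDl mulr_ge0 ?sqr_ge0.
Qed.

Lemma radmean_sample_le (x : {ffun 'I_n -> X}) :
  radmean (fun e => maxabs (fun j => radsum e (fun k => g j (x k)))) <=
  60 * rad x * Num.sqrt B.
Proof.
apply: chaining => // q q0.
have [N [c [cN cP]]] := g_cover x q0; exists N, c; split => // j.
have [i ci] := cP j; exists i; apply: le_trans ci _.
rewrite ler_sqr ?nnegrE ?divr_ge0 ?(ltW sn_gt0) ?(ltW (rad_gt0 _)) ?exprn_ge0//.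
by rewrite ler_pM2r ?invr_gt0 ?exprn_gt0.
Qed.

(** Squaring is [2 * V]-Lipschitz on [[-V, V]], so the covers of the functions serve for the squares
    after scaling by [2 * V]. *)
Lemma radmean_sample_sqr_le (x : {ffun 'I_n -> X}) :
  radmean (fun e => maxabs (fun j => radsum e (fun k => g j (x k) ^+ 2))) <=
  60 * (2 * V * rad x) * Num.sqrt B.
Proof.
apply: chaining => //.
- by rewrite !mulr_gt0.
- move=> j; apply: (@le_trans _ _ (V ^+ 2 * \sum_k g j (x k) ^+ 2)).
    rewrite mulr_sumr; apply: ler_sum => k _.
    rewrite -[X in X <= _]/((g j (x k) ^+ 2) * (g j (x k) ^+ 2)).
    rewrite ler_wpM2r ?sqr_ge0// -(real_normK (num_real (g j _))).
    by rewrite ler_sqr ?nnegrE ?(ltW V_gt0).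
  rewrite exprMn; apply: ler_pM; rewrite ?sqr_ge0 ?sumr_ge0//.
    by move=> k _; rewrite sqr_ge0.
  by have := sqr_ge0 V; nra.
move=> q q0.
have [N [c [cN cP]]] := g_cover x q0.
(* The centres may leave [[-V, V]]; projecting them onto this interval does not increase their
   distance to the values of [g]. *)
pose clip (y : R) := Num.max (- V) (Num.min V y).
exists N, (fun i k => clip (c i k) ^+ 2); split => // j.
have [i ci] := cP j; exists i.
apply: (@le_trans _ _ ((2 * V) ^+ 2 * \sum_k (g j (x k) - c i k) ^+ 2)).
  rewrite mulr_sumr; apply: ler_sum => k _.
  have := g_le j (x k); rewrite ler_norml => /andP[g1 g2].
  rewrite subr_sqr exprMn mulrC; set u := g j (x k) in g1 g2 *; set z := c i k.
  have [c1 c2 c3] : [/\ - V <= clip z, clip z <= V & (u - clip z) ^+ 2 <= (u - z) ^+ 2].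
    by rewrite /clip /Num.max /Num.min; case: (ltrP V z) => h1; case: ltrP => h2; split; nra.
  apply: ler_pM; rewrite ?sqr_ge0//; nra.
apply: (@le_trans _ _ ((2 * V) ^+ 2 * (Num.sqrt n%:R * s / 2 ^+ q) ^+ 2)).
  by rewrite ler_wpM2l ?sqr_ge0.
rewrite -exprMn ler_sqr ?nnegrE ?mulr_ge0 ?invr_ge0 ?(ltW sn_gt0) ?(ltW V_gt0) ?(ltW (rad_gt0 _)) ?exprn_ge0 ?(ltW s_gt0) ?sqrtr_ge0//.
by rewrite -[leRHS]mulrA ler_pM2l ?mulr_gt0// ler_pM2r ?invr_gt0 ?exprn_gt0.
Qed.

(** The second moments are written as means over a ghost sample. For each fixed sign vector [e],
    swapping the two samples where [e] is true turns the difference of squares into a signed one, so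
    the average over [e] costs nothing; splitting the two samples gives the factor 2. *)
Lemma symmetrization : sample_mean sup_sqr <=
  n%:R * (2 * s) ^+ 2 + 2 * sample_mean (fun x : {ffun 'I_n -> X} => radmean (fun e =>
    maxabs (fun j => radsum e (fun k => g j (x k) ^+ 2)))).
Proof.
pose dif (x y : {ffun 'I_n -> X}) := maxabs (fun j => \sum_k (g j (x k) ^+ 2 - g j (y k) ^+ 2)).
have ghost x : sup_sqr x <= n%:R * (2 * s) ^+ 2 + sample_mean (dif x).
  apply: maxabs_le => [|j].
    apply: addr_ge0; first exact: mulr_ge0 (ler0n _ _) (sqr_ge0 _).
    by apply: sample_mean_ge0 => y; exact: maxabs_ge0.
  rewrite ger0_norm ?sumr_ge0// => [|k _]; last exact: sqr_ge0.
  have -> : \sum_k g j (x k) ^+ 2 = sample_mean (fun y : {ffun 'I_n -> X} =>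
      \sum_k g j (y k) ^+ 2 + \sum_k (g j (x k) ^+ 2 - g j (y k) ^+ 2)).
    rewrite -[LHS](sample_mean_cst n); apply: eq_bigr => y _; congr (_ * _).
    by rewrite -big_split/=; apply: eq_bigr => k _; rewrite addrC subrK.
  rewrite sample_meanD; apply: lerD.
    rewrite sample_mean_sum.
    rewrite (eq_bigr (fun=> \sum_u p u * g j u ^+ 2)); last first.
      by move=> k _; rewrite (sample_mean_coord k (fun u => g j u ^+ 2)).
    rewrite [leRHS]mulr_natl -[n in leRHS]card_ord -sumr_const.
    by apply: ler_sum => k _; exact: g_sqr.
  apply: sample_mean_le => y; apply: le_trans (ler_norm _) _.
  exact: (ler_maxabs (fun j => \sum_k (g j (x k) ^+ 2 - g j (y k) ^+ 2))).
apply: le_trans (sample_mean_le ghost) _.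
rewrite sample_meanD sample_mean_cst lerD2l -(radmean_cst n (sample_mean _)).
pose Q (e : {ffun 'I_n -> bool}) (x : {ffun 'I_n -> X}) := maxabs (fun j => radsum e (fun k => g j (x k) ^+ 2)).
have -> : 2 * sample_mean (fun x : {ffun 'I_n -> X} => radmean (fun e => Q e x)) =
    radmean (fun e => 2 * sample_mean (Q e)).
  rewrite radmeanZ; congr (_ * _).
  rewrite /radmean sample_meanZ sample_mean_sum//.
apply: radmean_le => e.
have -> : 2 * sample_mean (Q e) = sample_mean (fun x => sample_mean (fun y => Q e x + Q e y)).
  under [RHS]eq_bigr do rewrite sample_meanD sample_mean_cst.
  by rewrite -/(sample_mean _) sample_meanD sample_mean_cst mulr_natl mulr2n.
rewrite (sample_mean_swap e).
apply: sample_mean_le => x; apply: sample_mean_le => y.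
rewrite /Q.
have -> : maxabs (fun j => radsum e (fun k => g j (y k) ^+ 2)) =
    maxabs (fun j => radsum e (fun k => - g j (y k) ^+ 2)).
  apply: eq_bigr => j _; rewrite -[LHS]normrN; congr `| _ |.
  by rewrite /radsum -sumrN; apply: eq_bigr => k _; rewrite mulrN.
apply: le_trans (maxabsD _ _).
rewrite /dif le_eqVlt; apply/orP; left; apply/eqP.
apply: eq_bigr => j _; congr `| _ |; rewrite -radsumD /radsum.
apply: eq_bigr => k _; rewrite !ffunE /sign.
by case: (e k); rewrite ?expr0 ?expr1; ring.
Qed.

Lemma sample_radmean_le :
  sample_mean (fun x : {ffun 'I_n -> X} => radmean (fun e => maxabs (fun j => radsum e (fun k => g j (x k))))) <=
  14400 * V * B + 180 * Num.sqrt (n%:R * s ^+ 2 * B).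
Proof.
pose w : R := Num.sqrt (sample_mean sup_sqr + n%:R * s ^+ 2).
pose b : R := Num.sqrt B.
have ns0 : 0 <= n%:R * s ^+ 2 by rewrite mulr_ge0 ?sqr_ge0.
have D0 : 0 <= sample_mean sup_sqr.
  by apply: sample_mean_ge0 => x; exact: maxabs_ge0.
have w2 : w ^+ 2 = sample_mean sup_sqr + n%:R * s ^+ 2 by rewrite sqr_sqrtr ?addr_ge0.
have w0 : 0 <= w := sqrtr_ge0 _.
have b0 : 0 <= b := sqrtr_ge0 _.
have b2 : b ^+ 2 = B by rewrite /b sqr_sqrtr// (le_trans ler01).
have mrad : sample_mean rad <= w.
  apply: le_trans (sample_mean_sqrt _) _; first by move=> x; rewrite addr_ge0 ?maxabs_ge0.
  by rewrite sample_meanD sample_mean_cst.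
have c0 : 0 <= Num.sqrt n%:R * s := ltW sn_gt0.
set c := Num.sqrt n%:R * s in c0.
(* [5 = 4 + 1] collects [(2 * s) ^+ 2] and the [n s^2] term inside [rad]; [240 = 2 * 120] is the
   symmetrization factor times the chaining constant for the squares. *)
have sym : w ^+ 2 <= 5 * c ^+ 2 + 240 * V * b * w.
  rewrite w2 /c sn_sqr; have := symmetrization.
  have : sample_mean (fun x : {ffun 'I_n -> X} => radmean (fun e =>
    maxabs (fun j => radsum e (fun k => g j (x k) ^+ 2)))) <= 120 * V * b * sample_mean rad.
    rewrite -sample_meanZ; apply: sample_mean_le => x.
    by apply: le_trans (radmean_sample_sqr_le x) _; rewrite -/b; lra.
  have : 120 * V * b * sample_mean rad <= 120 * V * b * w.
    by rewrite ler_wpM2l// !mulr_ge0// ltW.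
  rewrite exprMn; lra.
(* Chaining for the squares has brought [w] back on the right-hand side: solve for it. *)
have wle : w <= 3 * c + 240 * V * b.
  rewrite leNgt; apply/negP => h.
  have Vb0 : 0 <= V * b by rewrite mulr_ge0// ltW.
  have h1 : 3 * c * w + 240 * V * b * w <= w ^+ 2 by nra.
  nra.
have -> : Num.sqrt (n%:R * s ^+ 2 * B) = c * b.
  by rewrite -sn_sqr sqrtrM ?sqr_ge0// sqrtr_sqr ger0_norm.
(* Inserting the bound on [w] yields [180 = 60 * 3] and [14400 = 60 * 240]. *)
apply: (@le_trans _ _ (60 * b * w)).
  apply: (@le_trans _ _ (60 * b * sample_mean rad)); last by rewrite ler_wpM2l// mulr_ge0.
  rewrite -sample_meanZ; apply: sample_mean_le => x.
  by apply: le_trans (radmean_sample_le x) _; rewrite -/b; lra.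
apply: (@le_trans _ _ (60 * b * (3 * c + 240 * V * b))); first by rewrite ler_wpM2l// mulr_ge0.
rewrite -b2; lra.
Qed.

End FiniteSample.

(** * Covers of block sums *)

Section EmpiricalCovering.
Context {R : realType} d {E : measurableType d}.

(** The VC condition speaks of probability measures; it will be applied to the uniform law on the
    pooled points of all blocks, counted with multiplicity. *)
Lemma empirical_probability (s : seq E) : (0 < size s)%N ->
  exists Q : probability E R, forall h : E -> R,
    measurable_fun setT h -> (forall x, 0 <= h x) ->
    (\int[Q]_x (h x)%:E = ((size s)%:R^-1 * \sum_(x <- s) h x)%:E)%E.
Proof.
case: s => [//|x0 s'] _; set s := x0 :: s'; set N := size s.
pose m i : {measure set E -> \bar R} := \d_(nth x0 s i).
have N0 : (0 < N)%N by [].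
have mT : msum m N setT = N%:R%:E.
  rewrite /msum/= (eq_bigr (fun=> 1%E)) => [|i _]; last by rewrite diracT.
  by rewrite sumEFin sumr_const card_ord.
have Ni : 0 <= N%:R^-1 :> R by rewrite invr_ge0.
pose q : {measure set E -> \bar R} := mscale (NngNum Ni) (msum m N).
have q1 : q setT = 1%E.
  have -> : q setT = ((N%:R^-1)%:E * msum m N setT)%E by [].
  by rewrite mT -EFinM mulVf// pnatr_eq0 -lt0n.
pose iQ := Measure_isProbability.Build _ _ _ q q1.
exists (HB.pack_for (probability E R) (Measure.sort q) iQ) => h mh h0 /=.
rewrite /q.
rewrite ge0_integral_mscale//=; first last.
- by move=> x _; rewrite lee_fin.
- exact/measurable_EFinP.
rewrite ge0_integral_measure_sum//; first last.
- exact/measurable_EFinP.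
- by move=> x _; rewrite lee_fin.
rewrite EFinM; congr (_ * _)%E.
rewrite (eq_bigr (fun i : 'I_N => (h (nth x0 s i))%:E)); last first.
  by move=> i _; rewrite integral_dirac//= ?diracT ?mul1e//; exact/measurable_EFinP.
by rewrite sumEFin (big_nth x0) big_mkord.
Qed.

Lemma L2norm_sqr (Q : probability E R) (f : E -> R) :
  (L2norm Q f `^ 2 = \int[Q]_x (f x ^+ 2)%:E)%E.
Proof.
rewrite /L2norm poweR_Lnorm//; apply: eq_integral => x _ /=.
by rewrite powR_mulrn// real_normK ?num_real.
Qed.

Lemma L2norm_cst (Q : probability E R) (U : R) : 0 < U ->
  L2norm Q (cst U) = U%:E.
Proof.
move=> U0; rewrite /L2norm unlock.
rewrite (eq_integral (fun=> (U ^+ 2)%:E)); last first.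
  by move=> x _ /=; rewrite powR_mulrn// gtr0_norm.
rewrite integral_cst// [X in (_ * X)%E]probability_setT mule1/=.
by rewrite -powR_mulrn ?(ltW U0)// -powRrM mulfV// powRr1// ltW.
Qed.

(** Cauchy-Schwarz within a block costs a factor [L], its maximal size, and the pooled list has at
    most [n * L] points; together they turn the squared empirical radius [(e * U) ^+ 2] into
    [n * (e * (L * U)) ^+ 2]. *)
Lemma vc_covering_blocks (F : set (E -> R)) (U C v L e : R) n (b : 'I_n -> seq E) :
  vc_type F (cst U) C v -> 0 < U -> 0 < L -> 0 < e < 1 ->
  (forall k, (size (b k))%:R <= L) ->
  exists N (c : 'I_N -> 'I_n -> R), N%:R <= C * e `^ (- v) + 1 /\
    forall f, F f -> exists i,
      \sum_k (\sum_(x <- b k) f x - c i k) ^+ 2 <= n%:R * (e * (L * U)) ^+ 2.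
Proof.
move=> [_ Fm v1 Cv cov] U0 L0 /andP[e0 e1] bL.
have C0 : 0 <= C by apply: le_trans Cv; exact: powR_ge0.
have eLU0 : 0 <= (e * (L * U)) ^+ 2 by exact: sqr_ge0.
pose s := flatten [seq b k | k <- enum 'I_n].
(* With no points there is no empirical measure, but then every block sum is 0 and one centre is
   enough. *)
have [s0|s0] := posnP (size s).
  exists 1%N, (fun _ _ => 0); split; first by rewrite lerDr mulr_ge0 ?powR_ge0.
  move=> f Ff; exists ord0; rewrite big1 => [|k _]; first exact: mulr_ge0 (ler0n _ _) eLU0.
  suff -> : b k = [::] by rewrite big_nil subr0 expr0n.
  apply/nilP; rewrite /nilp -leqn0 -s0 size_flatten /shape -map_comp sumnE big_map.
  by rewrite big_enum/= (bigD1 k)//= leq_addr.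
have [Q QP] := empirical_probability s0.
have := cov Q e; rewrite L2norm_cst// lte_fin U0 ltry e0 e1 => /(_ isT isT).
rewrite /covering_number => covQ.
(* The covering number is an infimum of cardinalities; the added 1 makes the inequality strict, so
   that an actual cover lies below the bound. *)
have /(le_lt_trans covQ) : ((C * e `^ (- v))%:E < (C * e `^ (- v) + 1)%:E)%E.
  by rewrite lte_fin ltrDl.
move=> /ereal_inf_lt[_ [N [c [cm cP]] <-]]; rewrite lte_fin => /ltW NC.
exists N, (fun i k => \sum_(x <- b k) c i x); split => // f Ff.
have [i Hi] := cP f Ff; exists i.
have [fm _] := Fm f Ff; have [cim _] := cm i.
pose h x := f x - c i x.
have hm : measurable_fun setT h by exact: measurable_funB.
have hQ : (size s)%:R^-1 * \sum_(x <- s) h x ^+ 2 <= (e * U) ^+ 2.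
  have := QP (fun x => h x ^+ 2) (measurable_funX _ hm) (fun x => sqr_ge0 _).
  rewrite -L2norm_sqr -lee_fin => <-.
  rewrite (_ : ((e * U) ^+ 2)%:E = ((e * U)%:E `^ 2)%E); last first.
    by rewrite poweR_EFin powR_mulrn// mulr_ge0 ?(ltW e0) ?(ltW U0).
  apply: gt0_ler_poweR => //; last by rewrite EFinM ltW.
  - by rewrite in_itv/= leey Lnorm_ge0.
  - by rewrite in_itv/= leey lee_fin mulr_ge0 ?(ltW e0) ?(ltW U0).
have CS k : (\sum_(x <- b k) f x - \sum_(x <- b k) c i x) ^+ 2 <= L * \sum_(x <- b k) h x ^+ 2.
  rewrite -sumrB; apply: (@le_trans _ _ ((size (b k))%:R * \sum_(x <- b k) h x ^+ 2)); last first.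
    by rewrite ler_wpM2r// sumr_ge0// => x _; exact: sqr_ge0.
  elim: (b k) => [|x t IH]; first by rewrite !big_nil expr0n mulr0.
  rewrite !big_cons -/(h x) /= -natr1.
  set A := \sum_(j <- t) (f j - c i j) in IH *; set T := \sum_(j <- t) h j ^+ 2 in IH *.
  have T0 : 0 <= T by apply: sumr_ge0 => y _; exact: sqr_ge0.
  have [t0|t0] := posnP (size t).
    move: IH; rewrite t0 mul0r => A0.
    have -> : A = 0 by apply/eqP; rewrite -sqrf_eq0 eq_le A0 sqr_ge0.
    have := sqr_ge0 (h x); nra.
  set z := (size t)%:R in IH *.
  have z1 : 1 <= z :> R by rewrite ler1n.
  have : 2 * h x * A <= z * h x ^+ 2 + T.
    have z0 : 0 < z by lra.
    rewrite -(ler_pM2l z0).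
    have := sqr_ge0 (z * h x - A); nra.
  nra.
apply: (@le_trans _ _ (\sum_k L * \sum_(x <- b k) h x ^+ 2)); first exact: ler_sum.
rewrite -mulr_sumr.
have -> : \sum_k \sum_(x <- b k) h x ^+ 2 = \sum_(x <- s) h x ^+ 2.
  by rewrite /s big_flatten/= big_map big_enum.
have sz : (size s)%:R <= n%:R * L.
  rewrite size_flatten /shape -map_comp sumnE big_map big_enum/= natr_sum.
  rewrite mulr_natl -[n in leRHS]card_ord -sumr_const; exact: ler_sum.
move: hQ; rewrite ler_pdivrMl ?ltr0n// => hQ.
apply: (@le_trans _ _ (L * ((size s)%:R * (e * U) ^+ 2))); first by rewrite ler_pM2l.
have -> : n%:R * (e * (L * U)) ^+ 2 = L * ((n%:R * L) * (e * U) ^+ 2) by ring.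
by rewrite ler_pM2l// ler_wpM2r// sqr_ge0.
Qed.

End EmpiricalCovering.

(** * Regeneration *)

Section MeasureComplements.
Context {R : realType} d {T : measurableType d} (mu : {measure set T -> \bar R}).
Local Open Scope ereal_scope.

Lemma ge0_integral_mrestr (D : set T) (mD : measurable D) (f : T -> \bar R) :
  measurable_fun setT f -> (forall x, 0 <= f x) ->
  \int[mrestr mu mD]_x f x = \int[mu]_(x in D) f x.
Proof.
move=> mf f0; have mDC := measurableC mD.
rewrite -(setUv D) ge0_integral_setU//=; first last.
- by rewrite disj_set2E setICr.
- by rewrite setUv.
rewrite [X in _ + X]null_set_integral ?adde0//; first last.
- by rewrite /= /mrestr setICl measure0.
- exact: measurable_funTS.
by apply: eq_measure_integral => A mA AD; rewrite /= /mrestr setIidl.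
Qed.

End MeasureComplements.

Lemma probability_setI_sure {R : realType} d {T : measurableType d}
    (P : probability T R) (A B : set T) :
  measurable A -> measurable B -> P A = 1%E -> P (A `&` B) = P B.
Proof.
move=> mA mB A1; rewrite [RHS](measureDI _ mB mA) setIC.
have mAC := measurableC mA; have mBA := measurableD mB mA.
transitivity (0 + P (B `&` A))%E; first by rewrite add0e.
congr (_ + _)%E; apply/esym/(subset_measure0 mBA mAC) => [w []//|].
by have := probability_setC P mA; rewrite A1 subee// => ->.
Qed.

Definition image_measure {R : realType} d d' (T : measurableType d)
    (T' : measurableType d') (mu : {measure set T -> \bar R}) (f : T -> T')
    (mf : measurable_fun setT f) : {measure set T' -> \bar R} :=
  measure_function_pushforward__canonical__measure_function_Measure mu mf.

Section Sequences.
Context d {T : measurableType d}.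

Definition cylinder (l : nat) (W : nat -> set T) : set (nat -> T) :=
  [set z | forall i, (i < l)%N -> W i (z i)].

Definition cylinders : set (set (nat -> T)) :=
  [set D | exists l W, (forall i, measurable (W i)) /\ D = cylinder l W].

(** The product sigma-algebra on paths, presented by a pi-system so that finite measures can be
    identified on cylinders. *)
Definition seqT := g_sigma_algebraType cylinders.

Lemma cylinders_setI : setI_closed cylinders.
Proof.
move=> _ _ [l [W [mW ->]]] [l' [W' [mW' ->]]].
exists (maxn l l'), (fun i => (if (i < l)%N then W i else setT) `&`
  (if (i < l')%N then W' i else setT)); split.
  by move=> i; apply: measurableI; case: ifP.
apply/seteqP; split=> z /=.
  by move=> [h h'] i il; split; case: ifPn => // ?; [exact: h|exact: h'].
move=> h; split=> i il; have /h[] : (i < maxn l l')%N by rewrite leq_max il ?orbT.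
  by rewrite il.
by rewrite il.
Qed.

Lemma measurable_coord i : measurable_fun setT (fun z : seqT => z i).
Proof.
move=> _ B mB; rewrite setTI; apply: sub_sigma_algebra.
exists i.+1, (fun j => if j == i then B else setT); split.
  by move=> j; case: ifP.
apply/seteqP; split=> z /= h.
  by move=> j _; case: eqP => // ->.
by have := h i (ltnSn i); rewrite eqxx.
Qed.

Lemma measurable_toseq d' (Om : measurableType d') (phi : Om -> nat -> T) :
  (forall i, measurable_fun setT (phi^~ i)) ->
  measurable_fun setT (phi : Om -> seqT).
Proof.
move=> mphi; apply: (@measurability _ _ _ seqT setT _ cylinders) => //.
move=> _ [_ [l [W [mW ->]]] <-]; rewrite setTI.
have -> : phi @^-1` cylinder l W = \bigcap_(i in `I_l) (phi^~ i @^-1` W i).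
  by apply/seteqP; split=> w.
apply: fin_bigcap_measurable; first exact: finite_II.
by move=> i _; rewrite -[X in measurable X]setTI; exact: mphi.
Qed.

End Sequences.

Arguments cylinders {d T}.
Arguments seqT {d} T.

(** * Entrance times and the first block of a path *)

Section EntranceTimes.
Context {R : realType} {Om T : Type} (X : nat -> Om -> T) (B : set T).
Local Open Scope ereal_scope.

Local Notation et := (entrance_time R X B).

Lemma ereal_inf_min (D : set nat) n : D n -> (forall m, D m -> (n <= m)%N) ->
  ereal_inf [set i%:R%:E | i in D] = n%:R%:E :> \bar R.
Proof.
move=> Dn Dmin; apply/eqP; rewrite eq_le; apply/andP; split.
  by apply: ereal_inf_lbound; exists n.
by apply: le_ereal_inf_tmp => _ [m Dm <-]; rewrite lee_fin ler_nat Dmin.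
Qed.

Lemma ereal_inf_natP (D : set nat) :
  (D = set0 /\ ereal_inf [set i%:R%:E | i in D] = +oo :> \bar R) \/
  exists n, [/\ D n, forall m, D m -> (n <= m)%N &
    ereal_inf [set i%:R%:E | i in D] = n%:R%:E :> \bar R].
Proof.
have [[n Dn]|] := pselect (exists n, D n); last first.
  move=> nD; left; have -> : D = set0 by apply/seteqP; split=> // n Dn; case: nD; exists n.
  by rewrite image_set0 ereal_inf0.
right; have ex : exists n, `[< D n >] by exists n; apply/asboolP.
have [n0 /asboolP Dn0 min0] := ex_minnP ex.
have mn m : D m -> (n0 <= m)%N by move=> Dm; apply: min0; apply/asboolP.
by exists n0; split => //; exact: ereal_inf_min.
Qed.

Lemma entrance_time_cases k w : et k w = +oo \/ exists t, et k w = t%:R%:E.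
Proof.
case: k => [|k]; first by right; exists 0%N.
rewrite /=; have [[_ ->]|[n [_ _ ->]]] := ereal_inf_natP [set n | et k w < n%:R%:E /\ B (X n w)].
  by left.
by right; exists n.
Qed.

Lemma entrance_timeSP k w t : et k.+1 w = t%:R%:E <->
  exists s, [/\ (s < t)%N, et k w = s%:R%:E, B (X t w) &
    forall i, (s < i < t)%N -> ~ B (X i w)].
Proof.
set D := [set n | et k w < n%:R%:E /\ B (X n w)].
have -> : et k.+1 w = ereal_inf [set i%:R%:E | i in D] by [].
split.
  have [[_ ->]//|[n [[en Bn] nmin ->]]] := ereal_inf_natP D.
  move=> [/eqP]; rewrite eqr_nat => /eqP nt; rewrite {n}nt in en Bn nmin *.
  have [e|[s es]] := entrance_time_cases k w; first by move: en; rewrite e.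
  exists s; split => //; first by move: en; rewrite es lte_fin ltr_nat.
  move=> i /andP[si it] Bi.
  have := nmin i; rewrite leqNgt it => /(_ _)/negP; apply => //.
  by split => //=; rewrite es lte_fin ltr_nat.
move=> [s [st es Bt nB]]; apply: ereal_inf_min.
  by split => //=; rewrite es lte_fin ltr_nat.
move=> m [/=]; rewrite es lte_fin ltr_nat => sm Bm; rewrite leqNgt; apply/negP => mt.
by apply: (nB m) => //; rewrite sm mt.
Qed.

End EntranceTimes.

Section FirstBlock.
Context {T : Type} (A : set T).

(** Index 0 of [z] is the first step after an entrance, so a first visit at index [l] closes a block
    of length [l.+1]. *)
Definition hit (l : nat) : set (nat -> T) :=
  [set z | A (z l) /\ forall i, (i < l)%N -> ~ A (z i)].

Lemma hit_inj l l' z : hit l z -> hit l' z -> l = l'.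
Proof.
move=> [Al nA] [Al' nA']; have [h|h|//] := ltngtP l l'; first by case: (nA' l h).
by case: (nA l' h).
Qed.

(* Blocks longer than [m] are replaced by the empty block. *)
Definition first_block (m : nat) (z : nat -> T) : seq T :=
  if pselect (exists l, (l < m)%N /\ hit l z) is left h then
    mkseq z (projT1 (cid h)).+1
  else [::].

Lemma first_block_hit m l z : hit l z ->
  first_block m z = if (l < m)%N then mkseq z l.+1 else [::].
Proof.
move=> hl; rewrite /first_block; case: pselect => [h|h].
  by case: cid => /= l' [lm hl']; rewrite (hit_inj hl hl') lm.
by case: ifPn => // lm; case: h; exists l.
Qed.

Lemma first_block_nohit m z : (forall l, (l < m)%N -> ~ hit l z) ->
  first_block m z = [::].
Proof.
by move=> h; rewrite /first_block; case: pselect => // -[l [lm hl]]; case: (h l lm hl).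
Qed.

Lemma size_first_block m z : (size (first_block m z) <= m)%N.
Proof.
rewrite /first_block; case: pselect => //= h.
by rewrite size_map size_iota; case: cid => /= l [].
Qed.

(** A block is determined by its own entries; this is what makes it known by the time of the
    entrance that closes it. *)
Lemma first_block_agree m l z z' : hit l z ->
  (forall i, (i <= l)%N -> z' i = z i) -> first_block m z' = first_block m z.
Proof.
move=> hl zz'; have hl' : hit l z'.
  case: hl => Al nA; split; first by rewrite zz'.
  by move=> i il; rewrite zz' ?(ltnW il)//; exact: nA.
rewrite (first_block_hit m hl) (first_block_hit m hl'); case: ifP => // _.
apply: (@eq_from_nth _ (z 0%N)); rewrite !size_mkseq// => i il.
by rewrite !nth_mkseq// zz'.
Qed.

End FirstBlock.

(** * Regeneration at an atom for a process with the Markov property *)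

Section RegenerativeProcess.
Context {R : realType} dO (Om : measurableType dO) (P : probability Om R).
Context d (T : measurableType d) (Z : nat -> {mfun Om >-> T}).
Context (K : T -> set T -> \bar R) (A : set T) (q : set T -> \bar R).
Local Open Scope ereal_scope.

Hypothesis mK : forall B, measurable B -> measurable_fun setT (K^~ B).
Hypothesis K_ge0 : forall z B, measurable B -> 0 <= K z B.
Hypothesis mA : measurable A.
Hypothesis K_atom : forall z B, A z -> measurable B -> K z B = q B.
Hypothesis Z_markov : markov_property K P Z.
Hypothesis Z0_atom : P (Z 0%N @^-1` A) = 1.

Definition past (t : nat) : set (set Om) := sigma_of (fun i => Z i : Om -> T) `I_t.+1.
Definition pastT (t : nat) :=
  g_sigma_algebraType (\bigcup_(i in `I_t.+1) preimage_set_system setT (Z i : Om -> T) measurable).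

(** Starts strictly after [t]: a block excludes the visit to the atom that opens it and includes the
    one that closes it. *)
Definition future (t : nat) (w : Om) : nat -> T := fun i => Z (t + i.+1)%N w.

Lemma past_preimage t i B : (i <= t)%N -> measurable B -> past t (Z i @^-1` B).
Proof.
move=> it mB; apply: sub_sigma_algebra; exists i => //=; exists B => //.
by rewrite setTI.
Qed.

Lemma past_mono s t : (s <= t)%N -> past s `<=` past t.
Proof.
move=> st; apply: smallest_sub; first exact: smallest_sigma_algebra.
move=> _ [i /= it [B mB <-]]; rewrite setTI.
by apply: past_preimage => //; rewrite (leq_trans _ st).
Qed.

Lemma past_measurable t G : past t G -> measurable G.
Proof.
apply: smallest_sub; first exact: sigma_algebra_measurable.
by move=> _ [i _ [B mB <-]]; exact: measurable_funP.
Qed.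

Lemma pastI t G H : past t G -> past t H -> past t (G `&` H).
Proof. exact: (@measurableI _ (pastT t)). Qed.

Lemma past_toseq t (c : nat -> nat) W : (forall i, (c i <= t)%N) ->
  measurable (W : set (seqT T)) ->
  past t ((fun w i => Z (c i) w) @^-1` W).
Proof.
move=> ct mW.
have : measurable_fun setT ((fun w i => Z (c i) w) : pastT t -> seqT T).
  apply: measurable_toseq => i _ B mB; rewrite setTI.
  exact: past_preimage.
by move=> /(_ measurableT _ mW); rewrite setTI.
Qed.

Lemma measurable_future t : measurable_fun setT (future t : Om -> seqT T).
Proof. by apply: measurable_toseq => i; exact: measurable_funP. Qed.

Definition restricted_law (c : {nonneg R}) t G (mG : measurable G) : {measure set T -> \bar R} :=
  mscale c (image_measure (mrestr P mG) (measurable_funPT (Z t))).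

(* The conditional law of the future given [G] depends on [G] only through the law of
   [Z_t] on [G].  Events are compared up to the weights [c1], [c2], since [K] is only a
   set function and no conditional law of the whole future is available. *)
Lemma law_step (c1 c2 : {nonneg R}) t1 t2 G1 G2 :
  past t1 G1 -> past t2 G2 ->
  (forall B, measurable B -> c1%:num%:E * P (G1 `&` Z t1 @^-1` B) =
                            c2%:num%:E * P (G2 `&` Z t2 @^-1` B)) ->
  forall B, measurable B -> c1%:num%:E * P (G1 `&` Z t1.+1 @^-1` B) =
                            c2%:num%:E * P (G2 `&` Z t2.+1 @^-1` B).
Proof.
move=> pG1 pG2 law B mB; have mKB := mK mB.
have E (c : {nonneg R}) t G (mG : measurable G) : past t G ->
    c%:num%:E * P (G `&` Z t.+1 @^-1` B) = \int[restricted_law c t mG]_z K z B.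
  move=> pG; rewrite ge0_integral_mscale//; last by move=> *; exact: K_ge0.
  congr (_ * _); rewrite ge0_integral_pushforward//; last by move=> *; exact: K_ge0.
  rewrite preimage_setT ge0_integral_mrestr//.
  - exact: Z_markov.
  - exact: measurableT_comp.
  - by move=> *; exact: K_ge0.
rewrite (E c1 t1 G1 (past_measurable pG1))// (E c2 t2 G2 (past_measurable pG2))//.
apply: eq_measure_integral => D mD _.
rewrite -[LHS]/(c1%:num%:E * P (Z t1 @^-1` D `&` G1)).
by rewrite -[RHS]/(c2%:num%:E * P (Z t2 @^-1` D `&` G2)) ![Z _ @^-1` _ `&` _]setIC law.
Qed.

Definition cyl t l W := future t @^-1` cylinder l W.

Lemma cylS t l W : cyl t l.+1 W =
  Z t.+1 @^-1` W 0%N `&` cyl t.+1 l (fun i => W i.+1).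
Proof.
apply/seteqP; split=> w /=.
  move=> h; split; first by have := h 0%N isT; rewrite /future addn1.
  by move=> i il; have := h i.+1 il; rewrite /future addSnnS.
by move=> [h0 h] [|i] il; rewrite /future ?addn1// -addSnnS; exact: h.
Qed.

(** Induction on the length: the constraint on the next coordinate is absorbed into the past event,
    and [law_step] restores the proportionality of laws one time unit later. *)
Lemma law_cylinder (c1 c2 : {nonneg R}) l W t1 t2 G1 G2 :
  (forall i, measurable (W i)) -> past t1 G1 -> past t2 G2 ->
  (forall B, measurable B -> c1%:num%:E * P (G1 `&` Z t1 @^-1` B) =
                            c2%:num%:E * P (G2 `&` Z t2 @^-1` B)) ->
  c1%:num%:E * P (G1 `&` cyl t1 l W) = c2%:num%:E * P (G2 `&` cyl t2 l W).
Proof.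
elim: l W t1 t2 G1 G2 => [|l IH] W t1 t2 G1 G2 mW pG1 pG2 law.
  have cyl0 t : cyl t 0 W = setT by apply/seteqP; split.
  by have := law setT measurableT; rewrite !preimage_setT !cyl0.
rewrite !cylS !setIA; apply: IH => // [||B mB].
- apply: pastI; first exact: past_mono pG1.
  exact: past_preimage.
- apply: pastI; first exact: past_mono pG2.
  exact: past_preimage.
- rewrite -!setIA.
  exact: (law_step pG1 pG2 law (measurableI _ _ (mW 0%N) mB)).
Qed.

(** The laws of [Z_t] on [G] and of [Z_0] may differ inside the atom. They become proportional, with
    ratio [P G], only after one step, because the kernel is constant on the atom; from there
    [law_cylinder] applies, and cylinders determine finite measures. *)
Lemma regeneration t G W : past t G -> G `<=` Z t @^-1` A ->
  measurable (W : set (seqT T)) ->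
  P (G `&` future t @^-1` W) = P G * P (future 0 @^-1` W).
Proof.
move=> pG GA mW; have mG := past_measurable pG.
have c0 : (0 <= fine (P G))%R by exact: fine_ge0.
pose c := NngNum c0.
have cE : c%:num%:E = P G by rewrite /c/= fineK// fin_num_measure.
pose m1 := image_measure (mrestr P mG) (measurable_future t).
pose m2 : {measure set (seqT T) -> \bar R} := mscale c (image_measure P (measurable_future 0)).
have -> : P (G `&` future t @^-1` W) = m1 W.
  by rewrite /m1/= /pushforward /mrestr setIC.
have -> : P G * P (future 0 @^-1` W) = m2 W by rewrite -cE.
have m12 D : cylinders D -> m1 D = m2 D.
  move=> [l [V [mV ->]]].
  rewrite -[LHS]/(P (cyl t l V `&` G)) -[RHS]/(c%:num%:E * P (cyl 0 l V)) cE setIC.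
  case: l => [|l].
    have cyl0 s : cyl s 0 V = setT by apply/seteqP; split.
    by rewrite !cyl0 setIT probability_setT mule1.
  rewrite !cylS !setIA.
  have p0 : past 0 (Z 0%N @^-1` A) by exact: past_preimage.
  have step0 B : measurable B -> P (Z 0%N @^-1` A `&` Z 1%N @^-1` B) = q B.
    move=> mB; rewrite (Z_markov p0 mB).
    rewrite (eq_integral (cst (q B))); last by move=> w; rewrite inE => Aw; exact: K_atom.
    have mZ0 := past_measurable p0.
    by rewrite integral_cst// [X in _ * X]Z0_atom mule1.
  have stept B : measurable B -> P (G `&` Z t.+1 @^-1` B) = P G * q B.
    move=> mB; rewrite (Z_markov pG mB).
    rewrite (eq_integral (cst (q B))); last first.
      by move=> w; rewrite inE => /GA Aw; exact: K_atom.
    by rewrite integral_cst//; exact: muleC.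
  have mV0 : measurable (Z 1%N @^-1` V 0%N) by exact: past_measurable (past_preimage (leqnn 1) (mV 0%N)).
  have mcyl : measurable (cyl 1%N l (fun i => V i.+1)).
    rewrite -[X in measurable X]setTI; apply: measurable_future => //.
    by apply: sub_sigma_algebra; exists l, (fun i => V i.+1); split.
  rewrite -(probability_setI_sure (past_measurable p0) (measurableI _ _ mV0 mcyl) Z0_atom).
  rewrite setIA.
  pose one : {nonneg R} := NngNum (@ler01 R).
  have oneE x : one%:num%:E * x = x by rewrite mul1e.
  have := @law_cylinder one c l (fun i => V i.+1) t.+1 1%N (G `&` Z t.+1 @^-1` V 0%N)
    (Z 0%N @^-1` A `&` Z 1%N @^-1` V 0%N) (fun i => mV i.+1).
  rewrite oneE cE; apply.
  - by apply: pastI; [exact: past_mono pG|exact: past_preimage].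
  - by apply: pastI; [exact: past_mono p0|exact: past_preimage].
  - move=> B mB; rewrite -!setIA.
    have mVB : measurable (V 0%N `&` B) by exact: measurableI.
    by have := stept _ mVB; rewrite -(step0 _ mVB) oneE.
have cT (i : nat) : cylinders (setT : set (nat -> T)).
  by exists 0%N, (fun=> setT); split => //; apply/seteqP; split.
have fin (i : nat) : m1 setT < +oo.
  rewrite -[X in X < _]/(P (setT `&` G)) setTI.
  by rewrite (le_lt_trans (probability_le1 _ mG))// ltry.
have cov : \bigcup_(k : nat) (setT : set (nat -> T)) = setT by rewrite bigcup_const.
exact: (@measure_unique _ R (seqT T) cylinders (fun=> setT) erefl
  (@cylinders_setI _ T) cT cov m1 m2 m12 fin W mW).
Qed.

Definition et k w := entrance_time R (fun i => Z i : Om -> T) A k w.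
Definition ev k t := [set w | et k w = t%:R%:E].
Definition finite_time k := \bigcup_t ev k t.

Lemma ev0 w : ev 0 0 w. Proof. by []. Qed.

Lemma ev_inj k s t w : ev k s w -> ev k t w -> s = t.
Proof. by rewrite /ev/= => -> [/eqP]; rewrite eqr_nat => /eqP. Qed.

Lemma ev_pred k t w : ev k.+1 t w -> exists2 s, (s < t)%N & ev k s w.
Proof. by move=> /entrance_timeSP[s []]; exists s. Qed.

Lemma evS_sub k t : ev k.+1 t `<=` Z t @^-1` A.
Proof. by move=> w /entrance_timeSP[s []]. Qed.

Lemma evS_hit k s t w : ev k s w ->
  (ev k.+1 t w <-> exists2 l, t = (s + l.+1)%N & hit A l (future s w)).
Proof.
move=> es; split.
  move=> /entrance_timeSP[s' [s't es' At nA]].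
  rewrite {s es}(ev_inj es es').
  exists (t - s').-1; first by lia.
  split; rewrite /future /=; first by rewrite (_ : (_ + _)%N = t)//; lia.
  by move=> i il; apply: nA; lia.
move=> [l -> [Al nA]]; apply/entrance_timeSP; exists s; split => //; first by lia.
move=> i si; have := nA (i - s).-1; rewrite /future (_ : (s + _)%N = i); last by lia.
by apply; lia.
Qed.

Lemma past_ev k t : past t (ev k t).
Proof.
elim: k t => [|k IH] t.
  case: t => [|t].
    by have -> : ev 0 0 = setT; [apply/seteqP; split|exact: (@measurableT _ (pastT 0))].
  have -> : ev 0 t.+1 = set0.
    by apply/seteqP; split=> // w [/eqP]; rewrite eq_sym pnatr_eq0.
  exact: (@measurable0 _ (pastT t.+1)).
have -> : ev k.+1 t = \bigcup_(s in `I_t) (ev k s `&` (Z t @^-1` A `&`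
    \bigcap_(i in `I_t) (if (s < i)%N then ~` (Z i @^-1` A) else setT))).
  apply/seteqP; split=> w /=.
    move=> /entrance_timeSP[s [st es At nA]]; exists s => //; split => //; split => //.
    by move=> i /= it; case: ifPn => // si /=; apply: nA; rewrite si.
  move=> [s st [es [At h]]]; apply/entrance_timeSP; exists s; split => //.
  by move=> i /andP[si it]; have := h i it; rewrite /= si.
apply: (@bigcup_measurable _ (pastT t)) => s /= st.
apply: pastI; first exact: past_mono (ltnW st) _ (IH s).
apply: pastI; first exact: past_preimage.
apply: (@bigcap_measurableType _ (pastT t)) => i /= it; case: ifP => _.
  by apply: (@measurableC _ (pastT t)); apply: past_preimage => //; exact: ltnW.
exact: (@measurableT _ (pastT t)).
Qed.

Arguments past_ev : clear implicits.

Lemma measurable_ev k t : measurable (ev k t).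
Proof. by have := past_measurable (past_ev k t). Qed.

Lemma measurable_finite_time k : measurable (finite_time k).
Proof. by apply: bigcupT_measurable => t; exact: measurable_ev. Qed.

Lemma measurable_hit l : measurable (hit A l : set (seqT T)).
Proof.
have -> : hit A l = (fun z => z l) @^-1` A `&`
    \bigcap_(i in `I_l) ~` ((fun z : nat -> T => z i) @^-1` A).
  by apply/seteqP; split=> z [].
apply: (@measurableI _ (seqT T)).
  by rewrite -[X in measurable X]setTI; exact: measurable_coord.
apply: (@bigcap_measurableType _ (seqT T)) => i _; apply: (@measurableC _ (seqT T)).
by rewrite -[X in measurable X]setTI; exact: measurable_coord.
Qed.

Definition after k (W : set (seqT T)) := \bigcup_t (ev k t `&` future t @^-1` W).

Lemma measurable_after k W : measurable W -> measurable (after k W).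
Proof.
move=> mW; apply: bigcupT_measurable => t; apply: measurableI (measurable_ev _ _) _.
by rewrite -[X in measurable X]setTI; exact: measurable_future.
Qed.

(** A strong Markov property, by splitting over the value of the entrance time; the third condition
    says that [G] belongs to the past of this stopping time. It needs [0 < k]: at entrance 0 the
    chain lies in the atom only almost surely. *)
Lemma regeneration_entrance k G W : (0 < k)%N -> measurable G ->
  (forall t, past t (G `&` ev k t)) -> P (finite_time k) = 1 -> measurable W ->
  P (G `&` after k W) = P G * P (future 0 @^-1` W).
Proof.
case: k => // k _ mG pG fin mW.
have tE F : trivIset setT (fun t => ev k.+1 t `&` F t).
  move=> s t _ _ [w [[ws _] [wt _]]]; exact: ev_inj ws wt.
have mS t : measurable (future t @^-1` W).
  by rewrite -[X in measurable X]setTI; exact: measurable_future.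
have -> : G `&` after k.+1 W = \bigcup_t (ev k.+1 t `&` (G `&` future t @^-1` W)).
  by rewrite setI_bigcupr; apply: eq_bigcupr => t _; rewrite setICA.
rewrite measure_bigcup//=; last first.
  by move=> t _; apply: measurableI (measurable_ev _ _) _; exact: measurableI.
rewrite (eq_eseriesr (g := fun t => P (future 0 @^-1` W) * P (G `&` ev k.+1 t))); last first.
  move=> t _; rewrite setIA (setIC (ev _ _)) [RHS]muleC; apply: (regeneration (pG t)) => //.
  by apply: subset_trans (@evS_sub k t); exact: subIsetr.
have [r ->] : exists r : R, P (future 0 @^-1` W) = r%:E.
  by exists (fine (P (future 0 @^-1` W))); rewrite fineK// fin_num_measure.
rewrite nneseriesZl//.
rewrite [LHS]muleC; congr (_ * _).
under eq_eseriesr do rewrite setIC.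
rewrite -measure_bigcup//=; last by move=> t _; exact: measurableI (measurable_ev _ _) _.
rewrite -setI_bigcupl probability_setI_sure//.
exact: measurable_finite_time.
Qed.

Hypothesis finite_time1 : P (finite_time 1) = 1.

Lemma finite_timeS k : finite_time k.+1 = after k (\bigcup_l hit A l).
Proof.
apply/seteqP; split=> w.
  move=> [t _ et]; have [s _ es] := ev_pred et.
  have [l _ hl] := (evS_hit t es).1 et.
  by exists s => //; split => //; exists l.
move=> [s _ [es [l _ hl]]]; exists (s + l.+1)%N => //.
by apply/(evS_hit _ es); exists l.
Qed.

Lemma measurable_bigcup_hit : measurable (\bigcup_l hit A l : set (seqT T)).
Proof. by apply: (@bigcupT_measurable _ (seqT T)) => l; exact: measurable_hit. Qed.

(** By regeneration, a further entrance after the [k]-th one has the same probability as a first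
    entrance after time 0. *)
Lemma finite_time_sure k : P (finite_time k) = 1.
Proof.
case: k => [|k].
  rewrite (_ : finite_time 0 = setT) ?probability_setT//.
  by apply/seteqP; split=> // w _; exists 0%N.
elim: k => // k IH; rewrite finite_timeS -[after _ _]setTI.
rewrite regeneration_entrance//; last first.
- exact: measurable_bigcup_hit.
- by move=> t; rewrite setTI; exact: past_ev.
rewrite probability_setT mul1e -finite_time1 finite_timeS; congr (P _).
apply/seteqP; split=> w; first by move=> h; exists 0%N.
by move=> [t _ [et]]; rewrite (ev_inj et (ev0 w)).
Qed.

Variable m : nat.

Definition path_block k w : seq T :=
  if et k w is r%:E then first_block A m (future (Num.truncn r) w) else [::].

Lemma path_blockE k s w : ev k s w ->
  path_block k w = first_block A m (future s w).
Proof. by rewrite /path_block /ev/= => ->; rewrite natrK. Qed.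

Lemma path_block_infinite k w : ~ finite_time k w -> path_block k w = [::].
Proof.
move=> h; rewrite /path_block.
have [e|[t e]] : et k w = +oo \/ exists t, et k w = t%:R%:E by exact: entrance_time_cases.
  by rewrite e.
by case: h; exists t.
Qed.

Lemma size_path_block k w : (size (path_block k w) <= m)%N.
Proof. by rewrite /path_block; case: et => [r||] //; exact: size_first_block. Qed.

(** Lists carry no sigma-algebra here; a set of blocks is tested through the map that extracts the
    first block of a path. *)
Definition block_measurable (D : set (seq T)) :=
  measurable (first_block A m @^-1` D : set (seqT T)).

Lemma path_block_preimage k D :
  path_block k @^-1` D = after k (first_block A m @^-1` D) `|`
    (~` finite_time k `&` (if `[< D [::] >] then setT else set0)).
Proof.
apply/seteqP; split=> w /=.
  have [[t _ et]|nf] := pselect (finite_time k w).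
    by rewrite (path_blockE et) => Dw; left; exists t.
  by rewrite path_block_infinite// => D0; right; split => //; rewrite asboolT.
move=> [[t _ [et Dw]]|[nf]]; first by rewrite (path_blockE et).
by case: asboolP => // D0 _; rewrite path_block_infinite.
Qed.

Lemma measurable_path_block k D : block_measurable D ->
  measurable (path_block k @^-1` D).
Proof.
move=> mD; rewrite path_block_preimage; apply: measurableU.
  exact: measurable_after.
apply: measurableI; first by apply: measurableC; exact: measurable_finite_time.
by case: asboolP.
Qed.

Lemma path_block_after k D G : measurable G -> block_measurable D ->
  P (G `&` path_block k @^-1` D) = P (G `&` after k (first_block A m @^-1` D)).
Proof.
move=> mG mD; have mf := measurable_finite_time k.
have mA1 := measurable_after k mD.
rewrite -(probability_setI_sure mf (measurableI _ _ mG (measurable_path_block k mD)) (finite_time_sure k)).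
rewrite -[RHS](probability_setI_sure mf (measurableI _ _ mG mA1) (finite_time_sure k)).
congr (P _); rewrite path_block_preimage.
apply/seteqP; split=> w [fw [Gw]].
  by move=> [|[]].
by move=> aw; split => //; split => //; left.
Qed.

Let blocks_in (D : nat -> set (seq T)) n : set Om :=
  \bigcap_(k in `I_n) (path_block k.+1 @^-1` D k).

Let blocks_inS D n : blocks_in D n.+1 = blocks_in D n `&` path_block n.+1 @^-1` D n.
Proof.
apply/seteqP; split=> w /=.
  by move=> h; split=> [k /= kn|]; apply: h => //=; rewrite ltnW.
by move=> [h1 h2] k /=; rewrite ltnS leq_eqVlt => /orP[/eqP ->//|]; exact: h1.
Qed.

Let past_blocks_in D n t : (forall k, block_measurable (D k)) ->
  past t (blocks_in D n `&` ev n.+1 t).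
Proof.
move=> mD; elim: n t => [|n IH] t.
  rewrite (_ : blocks_in D 0 = setT); last by apply/seteqP; split.
  by rewrite setTI; exact: past_ev.
pose c s i := minn (s + i.+1)%N t.
have -> : blocks_in D n.+1 `&` ev n.+2 t = \bigcup_(s in `I_t)
    ((blocks_in D n `&` ev n.+1 s) `&`
     ((fun w i => Z (c s i) w) @^-1` (first_block A m @^-1` D n) `&` ev n.+2 t)).
  rewrite blocks_inS; apply/seteqP; split=> w /=.
    move=> [[Hw Dw] ew]; have [s st es] := ev_pred ew.
    exists s => //; split => //; split => //.
    have [l tl hl] := (evS_hit t es).1 ew.
    move: Dw; rewrite (path_blockE es) /=.
    rewrite (first_block_agree (z' := fun i => Z (c s i) w) m hl)// => i il.
    by rewrite /future /c (minn_idPl _)// tl leq_add2l.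
  move=> [s st [[Hw es] [Dw ew]]]; split => //; split => //.
  have [l tl hl] := (evS_hit t es).1 ew.
  rewrite (path_blockE es) /= -(first_block_agree (z' := fun i => Z (c s i) w) m hl)// => i il.
  by rewrite /future /c (minn_idPl _)// tl leq_add2l.
apply: (@bigcup_measurable _ (pastT t)) => s /= st.
apply: pastI; first exact: past_mono (ltnW st) _ (IH s).
apply: pastI; last exact: past_ev.
by apply: past_toseq; [move=> i; exact: geq_minr|exact: mD].
Qed.

(** The common law is that of the cycle following time 0, which is how moments under the atom's law
    come to control every block. *)
Lemma blocks_iid D n : (forall k, block_measurable (D k)) ->
  P (\bigcap_(k in `I_n) (path_block k.+1 @^-1` D k)) =
  \prod_(k < n) P (future 0 @^-1` (first_block A m @^-1` D k)).
Proof.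
move=> mD; rewrite -/(blocks_in D n); elim: n => [|n IH].
  rewrite big_ord0 (_ : blocks_in D 0 = setT) ?probability_setT//.
  by apply/seteqP; split.
have mB : measurable (blocks_in D n).
  apply: bigcap_measurableType => k _; exact: measurable_path_block.
rewrite big_ord_recr/= -IH blocks_inS path_block_after// regeneration_entrance//.
- by move=> t; exact: past_blocks_in.
- exact: finite_time_sure.
- exact: mD.
Qed.

Lemma prob_block_length k l : (0 < k)%N ->
  P (after k (hit A l)) = P (future 0 @^-1` hit A l).
Proof.
move=> k0; rewrite -[after _ _]setTI regeneration_entrance ?probability_setT ?mul1e//.
- by move=> t; rewrite setTI; exact: past_ev.
- exact: finite_time_sure.
- exact: measurable_hit.
Qed.

End RegenerativeProcess.

Arguments ev R {dO Om d T} Z A k t _.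
Arguments finite_time R {dO Om d T} Z A k _.
Arguments after R {dO Om d T} Z A k W _.
Arguments path_block R {dO Om d T} Z A m k w.

(** * Block sums of the split chain *)

Section SplitKernel.
Context {R : realType} d (E : measurableType d) (P : R.-pker E ~> E).
Context (S : set E) (delta : R) (Psi : probability E R).
Hypothesis small : small_set P 1 S delta Psi.
Local Open Scope ereal_scope.

Lemma small_set_measurable : measurable S.
Proof. by have [] := small. Qed.

Lemma small_set_minorization x B : S x -> measurable B ->
  delta%:E * Psi B <= P x B.
Proof.
move=> Sx mB; have [_ _ _ /(_ x B Sx mB)] := small; rewrite /kernel_pow.
by rewrite integral_indic// setIT.
Qed.

(** The upper bound is the minorization for the whole space, at a point of [S], which exists because
    [Psi S = 1]. *)
Lemma small_set_delta : (0 < delta <= 1)%R.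
Proof.
have [mS d0 PsiS _] := small; rewrite d0/=.
have [x Sx] : S !=set0.
  apply/set0P/eqP => S0; move: PsiS; rewrite S0 measure0 => /eqP.
  by rewrite eq_sym onee_eq0.
have := small_set_minorization Sx (@measurableT _ E).
by rewrite probability_setT mule1 prob_kernel lee_fin.
Qed.

Lemma measurable_atom : measurable (atom S).
Proof. by apply: measurableX => //; exact: small_set_measurable. Qed.

Lemma split_fst_ge0 z B : measurable B -> 0 <= split_fst P S delta Psi z B.
Proof.
move=> mB; have /andP[d0 d1] := small_set_delta.
rewrite /split_fst; case: ifPn => [zS|_]; last exact: measure_ge0.
case: z.2; first exact: measure_ge0.
(* For [delta = 1] the inverse is 0 by convention, so the sign is still right. *)
rewrite mule_ge0//; first by rewrite lee_fin invr_ge0 subr_ge0.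
rewrite sube_ge0; first by apply: small_set_minorization => //; rewrite inE in zS.
by rewrite fin_numM// fin_num_measure.
Qed.

Lemma measurable_split_fst B : measurable B ->
  measurable_fun setT (fun z => split_fst P S delta Psi z B).
Proof.
move=> mB; have mPB : measurable_fun setT (fun z : E * bool => P z.1 B).
  exact: (measurableT_comp (measurable_kernel P B mB) measurable_fst).
apply: measurable_fun_ifT => //.
  apply: (measurable_fun_bool true); rewrite setTI.
  rewrite (_ : _ @^-1` _ = S `*` setT).
    by apply: measurableX => //; exact: small_set_measurable.
  apply/seteqP; split=> z /=; first by move=> /set_mem.
  by move=> [Sz _]; exact: mem_set.
apply: measurable_fun_ifT => //.
apply: emeasurable_funM; first exact: measurable_cst.
apply: emeasurable_funB => //; exact: measurable_cst.
Qed.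

Lemma split_kernel_ge0 z W : measurable W -> 0 <= split_kernel P S delta Psi z W.
Proof.
move=> mW; have /andP[d0 d1] := small_set_delta.
rewrite adde_ge0// mule_ge0 ?lee_fin ?subr_ge0 ?(ltW d0)//.
  by apply: split_fst_ge0; exact: measurable_ysection.
by apply: split_fst_ge0; exact: measurable_ysection.
Qed.

Lemma measurable_split_kernel W : measurable W ->
  measurable_fun setT (fun z => split_kernel P S delta Psi z W).
Proof.
move=> mW; apply: emeasurable_funD; apply: emeasurable_funM;
  try exact: measurable_cst;
  by apply: measurable_split_fst; exact: measurable_ysection.
Qed.

(** The product of [Psi] and Bernoulli([delta]), computed through sections. *)
Definition atom_law (W : set (E * bool)) : \bar R :=
  delta%:E * Psi (ysection W true) + (1 - delta)%:E * Psi (ysection W false).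

Lemma split_kernel_atom z W : atom S z ->
  split_kernel P S delta Psi z W = atom_law W.
Proof.
move=> [/= Sz z2]; rewrite /split_kernel /split_fst.
by rewrite mem_set//= z2.
Qed.

End SplitKernel.

(** * Comparison of integrals with one side arbitrary *)

Section Integrals.
Context {R : realType} d (T : measurableType d) (mu : {measure set T -> \bar R}).
Local Open Scope ereal_scope.

Import HBNNSimple.

(** The integral of a nonnegative function is the supremum over the simple functions below it, and
    each of these can be compared almost everywhere with the measurable [g]. *)
Lemma ae_ge0_le_integral_nonmeasurable (N : set T) (f g : T -> \bar R) :
  measurable N -> mu (~` N) = 0 ->
  (forall w, 0 <= f w) -> (forall w, 0 <= g w) -> measurable_fun setT g ->
  (forall w, N w -> f w <= g w) -> \int[mu]_w f w <= \int[mu]_w g w.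
Proof.
move=> mN N0 f0 g0 mg fg.
rewrite ge0_integralTE//; apply: ge_ereal_sup => _ [h /= hf <-].
rewrite -integralT_nnsfun.
apply: ae_ge0_le_integral => //.
- by move=> x _; rewrite lee_fin.
- exact/measurable_EFinP.
- exists (~` N); split => //; first exact: measurableC.
  by move=> w /= h1 Nw; apply: h1 => _; exact: le_trans (hf w) (fg w Nw).
Qed.

Lemma ge0_le_integral_nonmeasurable (f g : T -> \bar R) :
  (forall w, 0 <= f w) -> (forall w, f w <= g w) ->
  \int[mu]_w f w <= \int[mu]_w g w.
Proof.
move=> f0 fg; have g0 w : 0 <= g w by exact: le_trans (fg w).
rewrite !ge0_integralTE//; apply: ereal_sup_le => _ [h /= hf <-].
by exists h => //= w; exact: le_trans (fg w).
Qed.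

Lemma ge0_le_integral_sure (N : set T) (f g : T -> \bar R) :
  measurable N -> mu (~` N) = 0 -> measurable_fun setT f ->
  (forall w, 0 <= f w) -> (forall w, 0 <= g w) ->
  (forall w, N w -> f w <= g w) -> \int[mu]_w f w <= \int[mu]_w g w.
Proof.
move=> mN N0 mf f0 g0 fg; have mNC := measurableC mN.
rewrite (ge0_negligible_integral mNC)// setTD setCK integral_mkcond.
apply: ge0_le_integral_nonmeasurable => w; rewrite patchE; case: ifPn => //.
by rewrite inE; exact: fg.
Qed.

End Integrals.

Section Discretisation.
Context {R : realType}.

Lemma measurable_truncn : measurable_fun setT (Num.truncn : R -> nat).
Proof.
have mle n : measurable [set x : R | (Num.truncn x <= n)%N].
  rewrite (_ : [set _ | _] = `]-oo, n.+1%:R[%classic) //.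
  by apply/seteqP; split=> x /=; rewrite in_itv/= truncn_le_nat.
have meq n : measurable [set x : R | Num.truncn x = n].
  case: n => [|n].
    rewrite (_ : [set _ | _] = [set x : R | (Num.truncn x <= 0)%N])//.
    by apply/seteqP; split=> x /=; [move=> ->|rewrite leqn0 => /eqP].
  rewrite (_ : [set _ | _] = [set x : R | (Num.truncn x <= n.+1)%N] `\`
                             [set x : R | (Num.truncn x <= n)%N]).
    exact: measurableD.
  apply/seteqP; split=> x /=; first by move=> ->; split => //; rewrite ltnn.
  by move=> [h1 /negP h2]; apply/eqP; rewrite eqn_leq h1 ltnNge.
move=> _ Y _; rewrite setTI.
rewrite (_ : _ @^-1` Y = \bigcup_(n in Y) [set x : R | Num.truncn x = n]).
  by apply: bigcup_measurable.
by apply/seteqP; split=> x /=; [move=> Yx; exists (Num.truncn x)|move=> [n Yn xn]; rewrite xn].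
Qed.

(** For [|y| <= V] the index is in range, and the default of [inord] does not come into play. *)
Definition cell (V eta : R) (y : R) : 'I_(Num.truncn (2 * V / eta)).+1 :=
  inord (Num.truncn ((y + V) / eta)).

Lemma measurable_cell V eta a : measurable (cell V eta @^-1` [set a]).
Proof.
have -> : cell V eta @^-1` [set a] =
    (fun y => Num.truncn ((y + V) / eta)) @^-1` [set k | inord k = a] by [].
rewrite -[X in measurable X]setTI.
apply: (measurableT_comp measurable_truncn) => //.
by apply: measurable_funM => //; exact: measurable_funD.
Qed.

Lemma cell_close V eta y y' : 0 < eta -> `|y| <= V -> `|y'| <= V ->
  cell V eta y = cell V eta y' -> `|y - y'| <= eta.
Proof.
move=> eta0 yV yV' /(congr1 val); rewrite /= !inordK.
- set u := (y + V) / eta; set u' := (y' + V) / eta => uu'.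
  have [u0 u0'] : 0 <= u /\ 0 <= u'.
    by move: yV yV'; rewrite !ler_norml => /andP[? _] /andP[? _];
      rewrite !divr_ge0 ?(ltW eta0)//; lra.
  have /andP[h1 h2] := truncn_itv u0; have /andP[h1' h2'] := truncn_itv u0'.
  rewrite uu' -natr1 in h1 h2; rewrite -natr1 in h2'.
  have -> : y - y' = eta * (u - u') by rewrite /u /u'; field; rewrite gt_eqF.
  rewrite normrM gtr0_norm// ler_piMr ?(ltW eta0)// ler_norml; apply/andP; split; lra.
- rewrite ltnS truncn_le_nat (@le_lt_trans _ _ (2 * V / eta)) ?truncnS_gt//.
  by rewrite ler_pM2r ?invr_gt0//; have := ler_norm y'; lra.
- rewrite ltnS truncn_le_nat (@le_lt_trans _ _ (2 * V / eta)) ?truncnS_gt//.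
  by rewrite ler_pM2r ?invr_gt0//; have := ler_norm y; lra.
Qed.

End Discretisation.

Section BlockSums.
Context {R : realType} d (E : measurableType d) (S : set E).
Hypothesis mS : measurable S.

Local Notation A := (atom S).

Definition path_sum (f : E -> R) (b : seq (E * bool)) : R := \sum_(z <- b) f z.1.

Lemma path_sum_le (f : E -> R) U (b : seq (E * bool)) :
  (forall x, `|f x| <= U) -> `|path_sum f b| <= (size b)%:R * U.
Proof.
move=> fU; rewrite /path_sum; elim: b => [|z b IH].
  by rewrite big_nil normr0 mul0r.
rewrite big_cons (le_trans (ler_normD _ _))//= -natr1 mulrDl mul1r addrC.
exact: lerD.
Qed.

Lemma path_sum_mkseq (f : E -> R) l (z : nat -> E * bool) :
  path_sum f (mkseq z l) = \sum_(i < l) f (z i).1.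
Proof. by rewrite /path_sum /mkseq big_map -[in LHS](subn0 l) big_mkord. Qed.

(** At most one [hit A l] holds, so a sum of random length becomes a fixed finite sum of coordinate
    functions times indicators, which is visibly measurable. *)
Lemma path_sum_first_block (f : E -> R) m z : path_sum f (first_block A m z) =
  \sum_(l < m) \sum_(i < l.+1) f (z i).1 * \1_(hit A l) z.
Proof.
have [[l [lm hl]]|nh] := pselect (exists l, (l < m)%N /\ hit A l z).
  rewrite (first_block_hit m hl) lm path_sum_mkseq (bigD1 (Ordinal lm))//=.
  rewrite [X in _ + X]big1 ?addr0.
    by apply: eq_bigr => i _; rewrite indicE mem_set// mulr1.
  move=> j /eqP jl; rewrite big1// => i _; rewrite indicE memNset ?mulr0// => hj.
  by apply: jl; apply: val_inj; exact: hit_inj hj hl.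
rewrite first_block_nohit ?/path_sum ?big_nil; last first.
  by move=> l lm hl; apply: nh; exists l.
rewrite big1// => l _; rewrite big1// => i _; rewrite indicE memNset ?mulr0// => hl.
by apply: nh; exists l.
Qed.

Lemma measurable_path_sum (f : E -> R) m : measurable_fun setT f ->
  measurable_fun setT (fun z : seqT (E * bool)%type => path_sum f (first_block A m z)).
Proof.
move=> mf; have -> : (fun z => path_sum f (first_block A m z)) =
    (fun z => \sum_(l < m) \sum_(i < l.+1) f (z i).1 * \1_(hit A l) z).
  by apply/funext => z; exact: path_sum_first_block.
apply: measurable_sum => l; apply: measurable_sum => i.
apply: measurable_funM.
  by apply: measurableT_comp => //; apply: measurableT_comp => //; exact: measurable_coord.
by apply: measurable_indic; apply: measurable_hit; exact: measurableX.
Qed.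

Context dO (Om : measurableType dO) (Z : nat -> {mfun Om >-> (E * bool)%type}).

Lemma sum_between_nat (t l : nat) (f : E -> R) w :
  sum_between Z t%:R%:E (t + l)%:R%:E f w = \sum_(i < l) f (Z (t + i.+1)%N w).1.
Proof.
rewrite /sum_between.
have -> : [set i : nat | ((t%:R : R)%:E < (i%:R : R)%:E <= ((t + l)%:R : R)%:E)%E] =
    [set` iota t.+1 l].
  apply/seteqP; split=> i /=; rewrite mem_iota lte_fin lee_fin ltr_nat ler_nat;
    by rewrite addSn ltnS.
rewrite -fsbig_seq ?iota_uniq// -[t.+1]addn0 iotaDl big_map -[in LHS](subn0 l) big_mkord.
by apply: eq_bigr => i _; rewrite addSnnS.
Qed.

Lemma block_sum_finite k t l (f : E -> R) w :
  ev R Z A k t w -> ev R Z A k.+1 (t + l)%N w ->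
  block_sum S Z f k w = \sum_(i < l) f (Z (t + i.+1)%N w).1.
Proof.
by move=> et etl; rewrite /block_sum /regen_time; rewrite -sum_between_nat; congr sum_between.
Qed.

Lemma block_event_ev k l j C w : block_event R S Z k l j C w <->
  exists t, [/\ ev R Z A k t w, ev R Z A k.+1 (t + l)%N w & C (Z (t + j)%N w).1].
Proof. by []. Qed.

Local Notation blockT := (g_sigma_algebraType
  [set G | exists k l j C, [/\ (1 <= k)%N, (1 <= j <= l)%N, measurable C &
                               G = block_event R S Z k l j C]]).

Lemma sigma_blocks_event k l j C : (0 < k)%N -> (0 < j <= l)%N -> measurable C ->
  sigma_blocks R S Z (block_event R S Z k l j C).
Proof. by move=> k0 jl mC; apply: sub_sigma_algebra; exists k, l, j, C. Qed.

Let time k w := Num.truncn (fine (entrance_time R (fun i => Z i : Om -> _) A k w)).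

Let timeE k t w : ev R Z A k t w -> time k w = t.
Proof. by move=> h; rewrite /time [entrance_time _ _ _ _ _]h /= natrK. Qed.

(** Expresses the sum through generators of [sigma_blocks], with respect to which the signs are
    independent. With [j = 1] and [C = setT], [block_event] records only the length of the block. *)
Lemma path_sum_path_block (f : E -> R) m k w :
  path_sum f (path_block R Z A m k w) = \sum_(l < m) \sum_(i < l.+1)
    ((fun w => f (Z (time k w + i.+1)%N w).1) \_ (block_event R S Z k l.+1 1 setT)) w.
Proof.
have BE l : block_event R S Z k l.+1 1 setT w ->
    ev R Z A k (time k w) w /\ hit A l (future Z (time k w) w).
  move=> /block_event_ev[t [et etl _]]; rewrite (timeE et); split => //.
  by have [l' /addnI[->]] := (evS_hit _ et).1 etl.
have [[l [lm bl]]|nh] := pselect (exists l, (l < m)%N /\ block_event R S Z k l.+1 1 setT w).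
  have [et hl] := BE _ bl.
  rewrite (path_blockE m et) (first_block_hit m hl) lm path_sum_mkseq (bigD1 (Ordinal lm))//=.
  rewrite [X in _ + X]big1 ?addr0.
    by apply: eq_bigr => i _; rewrite patchT ?inE.
  move=> j /eqP jl; rewrite big1// => i _; rewrite patchC// inE => bj.
  apply: jl; apply: val_inj; have [_ hj] := BE _ bj.
  exact: hit_inj hj hl.
rewrite big1 => [|l _]; last first.
  rewrite big1// => i _; rewrite patchC// inE => bl.
  by apply: nh; exists l.
have [[t _ et]|nf] := pselect (finite_time R Z A k w); last first.
  by rewrite path_block_infinite// /path_sum big_nil.
rewrite (path_blockE m et) first_block_nohit ?/path_sum ?big_nil// => l lm hl.
apply: nh; exists l; split => //; apply/block_event_ev; exists t; split => //.
by apply/(evS_hit _ et); exists l.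
Qed.

Lemma sigma_blocks_path_sum (f : E -> R) m k : (0 < k)%N -> measurable_fun setT f ->
  measurable_fun setT ((fun w => path_sum f (path_block R Z A m k w)) : blockT -> R).
Proof.
move=> k0 mf.
rewrite (_ : (fun w => _) = (fun w => \sum_(l < m) \sum_(i < l.+1)
    ((fun w => f (Z (time k w + i.+1)%N w).1) \_ (block_event R S Z k l.+1 1 setT)) w)); last first.
  by apply/funext => w; exact: path_sum_path_block.
apply: (@measurable_sum _ blockT) => l; apply: (@measurable_sum _ blockT) => i.
have mB : measurable (block_event R S Z k l.+1 1 setT : set blockT).
  exact: sigma_blocks_event.
apply/(measurable_restrictT _ mB) => _ Y mY.
rewrite (_ : _ `&` _ = block_event R S Z k l.+1 i.+1 (f @^-1` Y)).
  have mfY : measurable (f @^-1` Y) by rewrite -[X in measurable X]setTI; exact: mf.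
  have il : (0 < i.+1 <= l.+1)%N by exact: (ltn_ord i).
  exact: (sigma_blocks_event k0 il mfY).
apply/seteqP; split=> w /=.
  move=> [[t [et etl _]]]; rewrite /= (timeE et) => Yf.
  by exists t.
by move=> [t [et etl Yf]]; split; [exists t|rewrite /= (timeE et)].
Qed.

End BlockSums.

Section FiniteValued.
Context {R : realType} d (T : measurableType d) (P : probability T R).
Context (X : finType) (Q : T -> X) (mQ : forall x, measurable (Q @^-1` [set x])).

Lemma expectation_finite (c : X -> R) : (forall x, 0 <= c x) ->
  (\int[P]_w (c (Q w))%:E = (\sum_x fine (P (Q @^-1` [set x])) * c x)%:E)%E.
Proof.
move=> c0.
transitivity (\int[P]_w (\sum_(x <- index_enum X) (c x)%:E * (\1_(Q @^-1` [set x]) w)%:E))%E.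
  apply: eq_integral => w _; rewrite (bigD1_seq (Q w)) ?mem_index_enum ?index_enum_uniq//=.
  rewrite big1 ?adde0 => [|x /eqP xQ].
    by rewrite indicE mem_set// mule1.
  by rewrite indicE memNset ?mule0// => /= h; apply: xQ; rewrite h.
rewrite ge0_integral_sum//.
- rewrite -sumEFin; apply: eq_bigr => x _.
  rewrite ge0_integralZl//; last by rewrite lee_fin.
    rewrite integral_indic// setIT muleC EFinM fineK// fin_num_measure//.
  by apply/measurable_EFinP; exact: measurable_indic.
- move=> x; apply: emeasurable_funM; first exact: measurable_cst.
  by apply/measurable_EFinP; exact: measurable_indic.
- by move=> x w _; rewrite mule_ge0// lee_fin.
Qed.

Lemma sum_law_finite : \sum_x fine (P (Q @^-1` [set x])) = 1.
Proof.
have := @expectation_finite (fun=> 1) (fun=> ler01).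
rewrite (eq_integral (cst 1%E))// integral_cst// mul1e [X in X = _]probability_setT.
by move=> [->]; apply: eq_bigr => x _; rewrite mulr1.
Qed.

End FiniteValued.

Lemma probability_bigcap_sure {R : realType} d (T : measurableType d)
    (P : probability T R) (F : nat -> set T) :
  (forall k, measurable (F k)) -> (forall k, P (F k) = 1%E) ->
  P (\bigcap_k F k) = 1%E.
Proof.
move=> mF F1; have mI : measurable (\bigcap_k F k) by exact: bigcapT_measurable.
have F0 k : P.-negligible (~` F k).
  apply/negligibleP; first exact: measurableC.
  by apply: etrans (probability_setC P (mF k)) _; rewrite F1 subee.
have := negligible_bigcup F0; rewrite -setC_bigcap => /negligibleP.
move=> /(_ (measurableC mI)) => h.
have := etrans (esym (probability_setC P mI)) h; move/eqP.
by rewrite sube_eq ?fin_num_measure ?add0e// => /eqP <-.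
Qed.

Section Ext.
Variables (n : nat) (T : Type) (t0 : T).

(** Adapts families over ['I_n] to the independence statements, which are indexed by [nat]; the
    filler will be [setT]. *)
Definition ord_extend (h : 'I_n -> T) (k : nat) : T := oapp h t0 (insub k).

Lemma ord_extendE h (k : 'I_n) : ord_extend h k = h k.
Proof. by rewrite /ord_extend valK. Qed.

Lemma ord_extend_prop (Pr : T -> Prop) h : Pr t0 -> (forall k, Pr (h k)) ->
  forall k, Pr (ord_extend h k).
Proof. by move=> P0 Ph k; rewrite /ord_extend; case: insub => [i|] /=. Qed.

End Ext.

Section RademacherVariables.
Context {R : realType} d (E : measurableType d) (S : set E).
Context dO (Om : measurableType dO) (PA : probability Om R).
Context (Z : nat -> {mfun Om >-> (E * bool)%type}) (eps : nat -> {mfun Om >-> R}).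
Hypothesis rad : rademacher_indep_of_blocks S Z PA eps.
Local Open Scope ereal_scope.

Lemma eps_mutually_independent n (B : nat -> set R) : (forall k, measurable (B k)) ->
  PA (\bigcap_(k in `I_n) (eps k.+1 @^-1` B k)) =
  \prod_(k < n) PA (eps k.+1 @^-1` B k).
Proof.
move=> mB; have [_ _ mut _] := rad.
have := mut [fset k in iota 1 n]%fset (fun k => eps k @^-1` B k.-1).
have -> : \bigcap_(i in [set` [fset k in iota 1 n]%fset]) eps i @^-1` B i.-1 =
    \bigcap_(k in `I_n) (eps k.+1 @^-1` B k).
  apply/seteqP; split=> w h k /=.
    by move=> kn; apply: (h k.+1); rewrite /= !inE mem_iota.
  rewrite !inE mem_iota => /andP[k0 kn]; have := h k.-1; rewrite prednK//; apply.
  by move: k0 kn; case: k => //=.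
move=> ->.
  rewrite (perm_big (iota 1 n)); last first.
    apply: uniq_perm; rewrite ?fset_uniq ?iota_uniq// => k.
    by rewrite !inE.
  by rewrite -[1%N]addn0 iotaDl big_map -[in LHS](subn0 n) big_mkord.
by move=> k _; exists (B k.-1) => //; rewrite setTI.
Qed.

Lemma eps_blocks_independent n (B : nat -> set R) (G : set Om) :
  (forall k, measurable (B k)) -> sigma_blocks R S Z G ->
  PA ((\bigcap_(k in `I_n) (eps k.+1 @^-1` B k)) `&` G) =
  (\prod_(k < n) PA (eps k.+1 @^-1` B k)) * PA G.
Proof.
move=> mB sG; have [_ _ _ ind] := rad; rewrite -eps_mutually_independent//.
apply: ind => //.
pose epsT := g_sigma_algebraType (\bigcup_(i in setT)
   preimage_set_system setT (eps i : Om -> R) measurable).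
apply: (@bigcap_measurableType _ epsT) => k _; apply: sub_sigma_algebra.
by exists k.+1 => //; exists (B k) => //; rewrite setTI.
Qed.

(** The complement of -1 stands for the sign +1, so that the two events partition the space and a
    sign is defined everywhere, not only almost surely. *)
Lemma eps_sign k (b : bool) :
  PA (eps k @^-1` (if b then [set -1] else ~` [set -1]))%R = (2^-1)%:E.
Proof.
have [_ em _ _] := rad; case: b; first exact: em.
rewrite -preimage_setC probability_setC ?em.
  by rewrite -EFinB; congr (_%:E); lra.
rewrite -[X in measurable X]setTI; exact: measurable_funP.
Qed.

Definition eps_signs : set Om :=
  \bigcap_k (eps k @^-1` [set -1]%R `|` eps k @^-1` [set 1]%R).

Lemma measurable_eps_signs : measurable eps_signs.
Proof.
by apply: bigcapT_measurable => k; apply: measurableU;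
  rewrite -[X in measurable X]setTI; exact: measurable_funP.
Qed.

Lemma eps_signs_sure : PA eps_signs = 1.
Proof.
have [ep em _ _] := rad.
have mE k (r : R) : measurable (eps k @^-1` [set r]).
  by rewrite -[X in measurable X]setTI; exact: measurable_funP.
apply: probability_bigcap_sure => k; first exact: measurableU.
rewrite measureU//; last first.
  by apply/seteqP; split=> // w /= [-> /eqP]; rewrite eq_sym -subr_eq0 opprK => /eqP; lra.
rewrite [X in (X + _)%E]em [X in (_ + X)%E]ep -EFinD; congr (_%:E); lra.
Qed.

Lemma eps_signE w k : eps_signs w -> eps k w = sign (eps k w == -1)%R.
Proof.
move=> /(_ k Logic.I) []/= ->; first by rewrite eqxx /sign expr1.
by rewrite (_ : (1 == -1)%R = false) ?/sign ?expr0//; apply/negbTE/eqP => h; lra.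
Qed.

End RademacherVariables.

(** * Entropy of the block sums at dyadic scales *)

Section Covering.
Context {R : realType} d (E : measurableType d).
Context (F : set (E -> R)) (U C v sigma L : R).
Hypothesis U_gt0 : 0 < U.
Hypothesis L_gt0 : 0 < L.
Hypothesis sigma_gt0 : 0 < sigma.
Hypothesis sigma_le : sigma <= L * U.
Hypothesis vcF : vc_type F (cst U) C v.

Let LU_gt0 : 0 < L * U. Proof. by rewrite mulr_gt0. Qed.

Lemma vc_v_ge1 : 1 <= v. Proof. by have [_ _ ->] := vcF. Qed.

Lemma vc_C_gt0 : 0 < C.
Proof.
have [_ _ _ + _] := vcF; apply: lt_le_trans; rewrite powR_gt0// mulr_gt0.
Qed.

(* [sqrt e <= 2], hence [3 sqrt e >= e]. *)
Lemma vc_v_le_lnC : v <= ln C.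
Proof.
have v1 := vc_v_ge1; have C0 := vc_C_gt0; have [_ _ _ Cv _] := vcF; move: Cv.
rewrite -[(_ `^ _ <= C)]ler_ln ?posrE ?powR_gt0 ?mulr_gt0 ?sqrtr_gt0 ?expR_gt0//.
apply: le_trans; rewrite ln_powR ler_peMr//; first lra.
pose h := expR (1 / 2) : R.
have hh : expR 1 = h ^+ 2 :> R.
  by rewrite /h expr2 -expRD; congr expR; lra.
have h0 : 0 < h by exact: expR_gt0.
rewrite -ler_expR lnK ?posrE ?mulr_gt0 ?sqrtr_gt0 ?expR_gt0//.
rewrite hh sqrtr_sqr gtr0_norm//.
have hi := expRxMexpNx_1 (1 / 2 : R); have h2 := expR_ge1Dx (- (1 / 2) : R).
have h3 : h * expR (- (1/2)) = 1 by [].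
have : h <= 2 by nra.
nra.
Qed.

Let Lam := ln (C * L * U / sigma).

Let LamE : Lam = ln C + ln (L * U / sigma).
Proof. by rewrite -lnM ?posrE ?vc_C_gt0 ?divr_gt0// !mulrA. Qed.

Let lnV_ge0 : 0 <= ln (L * U / sigma).
Proof. by rewrite ln_ge0// ler_pdivlMr// mul1r. Qed.

(** Supplies the condition [1 <= B] of the chaining bound, from [1 <= v <= ln C] and
    [sigma <= L * U]. *)
Lemma vLam_ge1 : 1 <= v * Lam.
Proof.
have := vc_v_ge1; have := vc_v_le_lnC; have := lnV_ge0; rewrite LamE; nra.
Qed.

(** With [e = sigma / (L * U) / 2 ^+ q] the logarithm of [C * e ^ (- v) + 1] is at most [1 + ln C +
    v * ln (L * U / sigma) + v * q * ln 2]. The terms 1, [v * q * ln 2] and the remaining two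
    together are each at most [q * v * Lam], whence the 3. *)
Lemma covering_scale n (b : 'I_n -> seq (E * bool)) q :
  (forall k, (size (b k) <= Num.truncn L)%N) -> (0 < q)%N ->
  exists N (c : 'I_N -> 'I_n -> R), N%:R <= expR (q%:R * (3 * (v * Lam))) /\
    forall f, F f -> exists i,
      \sum_k (path_sum f (b k) - c i k) ^+ 2 <= (Num.sqrt n%:R * sigma / 2 ^+ q) ^+ 2.
Proof.
move=> bL q0; have v1 := vc_v_ge1; have vC := vc_v_le_lnC; have C0 := vc_C_gt0.
have p0 : 0 < 2 ^+ q :> R by rewrite exprn_gt0.
have p1 : 1 < 2 ^+ q :> R by rewrite exprn_egt1 -?lt0n//; lra.
pose e := sigma / (L * U) / 2 ^+ q.
have e0 : 0 < e by rewrite !divr_gt0.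
have e1 : e < 1.
  rewrite /e ltr_pdivrMr// mul1r; apply: le_lt_trans p1.
  by rewrite ler_pdivrMr// mul1r.
have bL' (k : 'I_n) : (size [seq z.1 | z <- b k])%:R <= L.
  rewrite size_map; apply: le_trans (_ : (Num.truncn L)%:R <= L).
    by rewrite ler_nat.
  by rewrite truncn_le ltW.
have e01 : 0 < e < 1 by rewrite e0 e1.
have [N [c [NC cP]]] := vc_covering_blocks vcF U_gt0 L_gt0 e01 bL'.
exists N, c; split.
  apply: le_trans NC _.
  have lne : ln e = - (ln (L * U / sigma) + q%:R * ln 2).
    rewrite /e ln_div ?posrE ?divr_gt0// lnXn// ln_div ?posrE// ln_div ?posrE//.
    by rewrite mulr_natl; lra.
  have -> : C * e `^ (- v) = expR (ln C + v * (ln (L * U / sigma) + q%:R * ln 2)).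
    rewrite expRD lnK ?posrE// /powR gt_eqF// lne; congr (_ * expR _); ring.
  set X := ln C + _.
  have ln21 : 0 <= ln (2 : R) <= 1.
    by rewrite ln_ge0/=; [have := @le_ln1Dx R 1; rewrite (_ : 1 + 1 = 2); [apply; lra|lra]|lra].
  have q1 : 1 <= q%:R :> R by rewrite ler1n.
  have X0 : 0 <= X.
    by move/andP : ln21 => [? ?]; rewrite addr_ge0 ?mulr_ge0 ?addr_ge0//; try lra; apply: mulr_ge0; lra.
  have e2 : 2 <= expR 1 :> R by have := expR_ge1Dx (1 : R); lra.
  have eX : 1 <= expR X by rewrite -[1]expR0 ler_expR.
  (* The added 1 is absorbed by a factor [expR 1 >= 2], as [expR X >= 1]. *)
  apply: (@le_trans _ _ (expR 1 * expR X)); first by nra.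
  rewrite -expRD ler_expR LamE /X.
  have y0 := lnV_ge0; set a := ln C in vC *; set y := ln (L * U / sigma) in y0 *.
  set z := ln 2 in ln21 *; set r := q%:R in q1 *.
  move/andP : ln21 => [z0 z1].
  have va : v <= v * a by nra.
  have vy : 0 <= v * y by apply: mulr_ge0 => //; lra.
  have : v * (r * z) <= r * (v * a).
    rewrite mulrCA ler_pM2l; [nra|lra].
  have : a + v * y <= r * (v * a + v * y) by nra.
  have : 1 <= r * (v * a) by nra.
  rewrite mulrDr; nra.
move=> f Ff; have [i ci] := cP f Ff; exists i.
rewrite (_ : _ ^+ 2 = n%:R * (e * (L * U)) ^+ 2).
  apply: le_trans ci; apply: ler_sum => k _.
  by rewrite /path_sum big_map.
rewrite -mulrA exprMn sqr_sqrtr//; congr (_ * _ ^+ 2).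
by rewrite /e; field; rewrite !gt_eqF.
Qed.

End Covering.

Lemma measurable_maxabs {R : realType} d (T : measurableType d) (I : finType) (h : I -> T -> R) :
  (forall j, measurable_fun setT (h j)) ->
  measurable_fun setT (fun w => maxabs (fun j => h j w)).
Proof.
move=> mh; rewrite /maxabs; elim: (index_enum I) => [|j r IH].
  by under eq_fun do rewrite big_nil; exact: measurable_cst.
under eq_fun do rewrite big_cons.
by apply: measurable_maxr => //; exact: measurableT_comp.
Qed.

(** If the chain failed to return with positive probability, [h] would be infinite on an event of
    positive measure. Either moment condition thus makes the first regeneration time almost surely
    finite. *)
Lemma finite_time_integrable {R : realType} d (E : measurableType d) (S : set E)
    dO (Om : measurableType dO) (PA : probability Om R)
    (Z : nat -> {mfun Om >-> (E * bool)%type}) (h : Om -> \bar R) :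
  measurable (atom S) -> (forall w, 0 <= h w)%E ->
  (forall w, regen_time R S Z 1 w = +oo -> h w = +oo)%E ->
  (\int[PA]_w h w < +oo)%E -> PA (finite_time R Z (atom S) 1) = 1%E.
Proof.
move=> mA h0 hoo; have mN := measurable_finite_time (R := R) Z mA 1.
have [N0 _|N0] := eqVneq (PA (~` finite_time R Z (atom S) 1)) 0%E.
  have := etrans (esym (probability_setC PA mN)) N0; move/eqP.
  by rewrite sube_eq ?fin_num_measure ?add0e// => /eqP <-.
suff -> : (\int[PA]_w h w = +oo)%E by [].
apply/eqP; rewrite -leye_eq.
apply: (@le_trans _ _ (\int[PA]_(w in ~` finite_time R Z (atom S) 1) +oo)%E).
  by rewrite integral_cst ?gt0_mulye ?lt0e ?N0 ?measure_ge0//; exact: measurableC.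
rewrite integral_mkcond; apply: ge0_le_integral_nonmeasurable => w; rewrite patchE; case: ifPn => //.
rewrite inE => nf; rewrite hoo//.
have [//|[t e]] : entrance_time R (fun i => Z i : Om -> _) (atom S) 1 w = +oo%E \/
  exists t, entrance_time R (fun i => Z i : Om -> _) (atom S) 1 w = t%:R%:E.
  exact: entrance_time_cases.
by case: nf; exists t.
Qed.

(** * Truncated and long blocks of the split chain *)

Section SplitChain.
Context {R : realType} d (E : measurableType d) (P : R.-pker E ~> E).
Context (S : set E) (delta : R) (Psi : probability E R).
Context dO (Om : measurableType dO) (PA : probability Om R).
Context (Z : nat -> {mfun Om >-> (E * bool)%type}).
Hypothesis small : small_set P 1 S delta Psi.
Hypothesis chain : split_chain_from_atom P S delta Psi PA Z.
Hypothesis finite_time1 : PA (finite_time R Z (atom S) 1) = 1%E.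
Local Notation A := (atom S).

Let K_atom z W : A z -> measurable W -> split_kernel P S delta Psi z W = atom_law delta Psi W.
Proof. by move=> Az _; exact: split_kernel_atom. Qed.

Lemma split_finite_time k : PA (finite_time R Z A k) = 1%E.
Proof.
have [Z0 ZM] := chain.
exact: (finite_time_sure (measurable_split_kernel small) (split_kernel_ge0 small)
  (measurable_atom small) K_atom ZM Z0 finite_time1).
Qed.

Lemma split_blocks_iid m D n : (forall k, block_measurable A m (D k)) ->
  (PA (\bigcap_(k in `I_n) (path_block R Z A m k.+1 @^-1` D k)) =
  \prod_(k < n) PA (future Z 0 @^-1` (first_block A m @^-1` D k)))%E.
Proof.
have [Z0 ZM] := chain.
exact: (blocks_iid (measurable_split_kernel small) (split_kernel_ge0 small)
  (measurable_atom small) K_atom ZM Z0 finite_time1).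
Qed.

Lemma split_block_length k l : (0 < k)%N ->
  PA (after R Z A k (hit A l)) = PA (future Z 0 @^-1` hit A l).
Proof.
have [Z0 ZM] := chain.
exact: (prob_block_length (measurable_split_kernel small) (split_kernel_ge0 small)
  (measurable_atom small) K_atom ZM Z0 finite_time1).
Qed.

Context (eps : nat -> {mfun Om >-> R}).
Hypothesis rad : rademacher_indep_of_blocks S Z PA eps.
Context (F : set (E -> R)) (U C v sigma L : R) (n : nat).
Hypothesis U_gt0 : 0 < U.
Hypothesis L_gt0 : 0 < L.
Hypothesis sigma_gt0 : 0 < sigma.
Hypothesis sigma_le : sigma <= L * U.
Hypothesis n_gt0 : (0 < n)%N.
Hypothesis vcF : vc_type F (cst U) C v.
Hypothesis variance : forall f, F f ->
  (\int[PA]_w ((cycle_sum S Z f w) ^+ 2)%:E <= (sigma ^+ 2)%:E)%E.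

Let V := L * U.
Let m := Num.truncn L.
Let mA : measurable A := measurable_atom small.
Let mS : measurable S := small_set_measurable small.

Let V_gt0 : 0 < V. Proof. by rewrite mulr_gt0. Qed.

Let path_sum_leV f b : F f -> (size b <= m)%N -> `|path_sum f b| <= V.
Proof.
move=> Ff bm; have [_ Fm _ _ _] := vcF; have [_ fU] := Fm f Ff.
apply: le_trans (path_sum_le b fU) _; rewrite ler_pM2r//.
by apply: (@le_trans _ _ m%:R); rewrite ?ler_nat// truncn_le ltW.
Qed.

Section FiniteSubclass.
Variables (M : nat) (f : 'I_M -> E -> R).
Hypothesis Ff : forall j, F (f j).

Let mf j : measurable_fun setT (f j).
Proof. by have [_ Fm _ _ _] := vcF; have [] := Fm _ (Ff j). Qed.

Section FixedMesh.
Variable eta : R.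
Hypothesis eta_gt0 : 0 < eta.
Hypothesis eta_le : eta <= sigma.

Let X : finType := {ffun 'I_M -> 'I_(Num.truncn (2 * V / eta)).+1}.
(* [f_j'] varies by at most [eta] on a cell.  Replacing each block by the representative
   [rep] of its cell turns the blocks into a sample from the finite space [X]. *)
Let cells (b : seq (E * bool)) : X := [ffun j => cell V eta (path_sum (f j) b)].
Let D (x : X) := [set b | cells b = x].

Let preimage_D (T : Type) (h : T -> seq (E * bool)) x : h @^-1` D x =
  \bigcap_(j in [set: 'I_M])
    ((fun t => path_sum (f j) (h t)) @^-1` (cell V eta @^-1` [set x j])).
Proof.
apply/seteqP; split=> t /=; first by move=> ht j _ /=; rewrite -ht ffunE.
by move=> ht; apply/ffunP => j; rewrite ffunE; exact: (ht j Logic.I).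
Qed.

Let mD x : block_measurable A m (D x).
Proof.
rewrite /block_measurable preimage_D; apply: fin_bigcap_measurable; first exact: finite_finset.
move=> j _; rewrite -[X in measurable X]setTI.
by apply: measurable_path_sum => //; exact: measurable_cell.
Qed.

Let sigma_blocks_D k x : (0 < k)%N -> sigma_blocks R S Z (path_block R Z A m k @^-1` D x).
Proof.
move=> k0; rewrite preimage_D.
pose blockT := g_sigma_algebraType
  [set G | exists k l j C, [/\ (1 <= k)%N, (1 <= j <= l)%N, measurable C &
                               G = block_event R S Z k l j C]].
apply: (@fin_bigcap_measurable _ blockT); first exact: finite_finset.
move=> j _; have h := sigma_blocks_path_sum (S := S) (Z := Z) m k0 (mf j).
by have := h measurableT _ (measurable_cell (V := V) (eta := eta) (x j)); rewrite setTI.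
Qed.

(** Cells met by no block of size at most [m] get the empty block, so the size bound, and with it
    the bounds and covers for [g], hold at every point of [X], even at those of weight 0. *)
Let rep (x : X) : seq (E * bool) :=
  if pselect (exists b, (size b <= m)%N /\ cells b = x) is left h then projT1 (cid h) else [::].

Let size_rep x : (size (rep x) <= m)%N.
Proof. by rewrite /rep; case: pselect => //= h; case: cid => /= b []. Qed.

Let g j (x : X) := path_sum (f j) (rep x).

Let g_close j b : (size b <= m)%N -> `|path_sum (f j) b - g j (cells b)| <= eta.
Proof.
move=> bm; have [rm rb] : (size (rep (cells b)) <= m)%N /\ cells (rep (cells b)) = cells b.
  rewrite /rep; case: pselect => [h|[]]; last by exists b.
  by case: cid => /= b' [].
apply: (@cell_close _ V) => //; [exact: path_sum_leV|exact: path_sum_leV|].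
by have /ffunP/(_ j) := rb; rewrite !ffunE.
Qed.

Let Q0 w := cells (first_block A m (future Z 0 w)).

Let mQ0 x : measurable (Q0 @^-1` [set x]).
Proof.
by have := @measurable_future _ _ _ _ Z 0 measurableT _ (mD x); rewrite setTI.
Qed.

Let p (x : X) := fine (PA (Q0 @^-1` [set x])).

Let p_ge0 x : 0 <= p x. Proof. exact: fine_ge0. Qed.

Let p_sum1 : \sum_x p x = 1. Proof. exact: sum_law_finite mQ0. Qed.

Let N0 : PA (~` finite_time R Z A 1) = 0%E.
Proof.
have mN := measurable_finite_time (R := R) Z mA 1.
by apply: etrans (probability_setC PA mN) _; rewrite finite_time1 subee.
Qed.

Let cycle_sum_first_block j l w : ev R Z A 1 l.+1 w -> hit A l (future Z 0 w) ->
  (l < m)%N -> cycle_sum S Z (f j) w = path_sum (f j) (first_block A m (future Z 0 w)).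
Proof.
move=> el hl lm; rewrite (first_block_hit m hl) lm path_sum_mkseq.
rewrite /cycle_sum /regen_time [entrance_time _ _ _ _ _]el.
exact: (sum_between_nat Z 0 l.+1 (f j) w).
Qed.

Let g_sqr j : \sum_x p x * g j x ^+ 2 <= (2 * sigma) ^+ 2.
Proof.
(* Since [z ^+ 2 <= 2 * y ^+ 2 + 2 * (y - z) ^+ 2], this is a lower bound for the squared cycle sum
   that depends on the cell alone. *)
pose c x := Num.max 0 (g j x ^+ 2 / 2 - eta ^+ 2).
have c0 x : 0 <= c x by rewrite le_max lexx.
have pc : \sum_x p x * c x <= sigma ^+ 2.
  rewrite -lee_fin -(expectation_finite PA mQ0 c0).
  apply: le_trans (variance (Ff j)).
  have mN := measurable_finite_time (R := R) Z mA 1.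
  apply: (ge0_le_integral_sure mN N0).
  - apply/measurable_EFinP => _ Y _; rewrite setTI.
    rewrite (_ : _ @^-1` Y = \bigcup_(x in [set x | Y (c x)]) (Q0 @^-1` [set x])).
      by apply: fin_bigcup_measurable => //; exact: finite_finset.
    by apply/seteqP; split=> w /=; [move=> h; exists (Q0 w)|move=> [x Yx ->]].
  - by move=> w; rewrite lee_fin.
  - by move=> w; rewrite lee_fin sqr_ge0.
  move=> w [t _ et]; rewrite lee_fin ge_max sqr_ge0/=.
  have [l tl hl] := (evS_hit t (ev0 Z A w)).1 et; rewrite add0n in tl.
  have [lm|ml] := ltnP l m.
    rewrite tl in et; rewrite (cycle_sum_first_block j et hl lm).
    have := g_close j (size_first_block A m (future Z 0 w)).
    rewrite -/(Q0 w) ler_norml; set y := path_sum _ _; set z := g _ _ => /andP[h1 h2].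
    have e0 := eta_gt0; have := sqr_ge0 (y - z); have := sqr_ge0 (2 * y - z).
    have : (y - z) ^+ 2 <= eta ^+ 2 by nra.
    rewrite !expr2; nra.
  (* A long first block is rounded as the empty one, so [|z| <= eta] and the lower bound is 0. *)
  have := g_close j (size_first_block A m (future Z 0 w)).
  rewrite -/(Q0 w) (first_block_hit m hl) ltnNge ml/= {1}/path_sum big_nil sub0r normrN.
  rewrite ler_norml; set z := g _ _ => /andP[h1 h2].
  have e0 := eta_gt0; have := sqr_ge0 (cycle_sum S Z (f j) w).
  have : z ^+ 2 <= eta ^+ 2 by nra.
  rewrite !expr2; nra.
have : \sum_x p x * g j x ^+ 2 <= \sum_x (2 * (p x * c x) + 2 * eta ^+ 2 * p x).
  apply: ler_sum => x _; have px := p_ge0 x.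
  have : g j x ^+ 2 / 2 - eta ^+ 2 <= c x by rewrite le_max lexx orbT.
  nra.
rewrite big_split/= -!mulr_sumr p_sum1 mulr1 => h; apply: le_trans h _.
have : eta ^+ 2 <= sigma ^+ 2.
  by rewrite ler_sqr ?nnegrE ?(ltW eta_gt0) ?(ltW sigma_gt0).
move: pc; nra.
Qed.

Let Q w : {ffun 'I_n -> bool} * {ffun 'I_n -> X} :=
  ([ffun k : 'I_n => eps k.+1 w == -1 :> R],
   [ffun k : 'I_n => cells (path_block R Z A m k.+1 w)]).

Let preimage_Q sx : Q @^-1` [set sx] =
  (\bigcap_(k in `I_n) (eps k.+1 @^-1` ord_extend setT
     (fun k => if sx.1 k then [set -1] else ~` [set -1]) k)) `&`
  (\bigcap_(k in `I_n) (path_block R Z A m k.+1 @^-1` ord_extend setT (fun k => D (sx.2 k)) k)).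
Proof.
case: sx => s x; apply/seteqP; split=> w /=.
  move=> [hs hx]; split=> k /= kn; rewrite -[k]/(val (Ordinal kn)) ord_extendE.
    have /ffunP/(_ (Ordinal kn)) := hs; rewrite ffunE/= => <-.
    by case: eqP.
  by have /ffunP/(_ (Ordinal kn)) := hx; rewrite ffunE.
move=> [hs hx]; congr pair; apply/ffunP => k; rewrite ffunE.
  have := hs k (ltn_ord k); rewrite /= ord_extendE; case: (s k) => /= [->|/eqP/negbTE //].
  by rewrite eqxx.
by have := hx k (ltn_ord k); rewrite /= ord_extendE.
Qed.

Let signs_measurable s k :
  measurable (ord_extend setT (fun k : 'I_n => if s k then [set -1 : R] else ~` [set -1]) k).
Proof.
apply: (ord_extend_prop (Pr := measurable)) => // i.
by case: (s i) => //; exact: measurableC.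
Qed.

Let blocks_measurable (x : {ffun 'I_n -> X}) k :
  block_measurable A m (ord_extend setT (fun k => D (x k)) k).
Proof.
apply: (ord_extend_prop (Pr := block_measurable A m)) => [|i]; last exact: mD.
exact: (@measurableT _ (seqT (E * bool)%type)).
Qed.

Let mQ sx : measurable (Q @^-1` [set sx]).
Proof.
rewrite preimage_Q; apply: measurableI; apply: bigcap_measurableType => k _.
  by rewrite -[X in measurable X]setTI; exact: measurable_funP (signs_measurable _ _).
by apply: measurable_path_block => //; exact: blocks_measurable.
Qed.

Let law_Q s x : fine (PA (Q @^-1` [set (s, x)])) = (2 ^+ n)^-1 * \prod_k p (x k).
Proof.
rewrite preimage_Q/= (eps_blocks_independent rad); last 2 first.
- by move=> k; exact: signs_measurable.
- pose blockT := g_sigma_algebraType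
    [set G | exists k l j C, [/\ (1 <= k)%N, (1 <= j <= l)%N, measurable C &
                                 G = block_event R S Z k l j C]].
  apply: (@bigcap_measurableType _ blockT) => k /= kn.
  rewrite -[X in ord_extend _ _ X]/(val (Ordinal kn)) ord_extendE.
  exact: sigma_blocks_D.
rewrite split_blocks_iid; last exact: blocks_measurable.
rewrite (eq_bigr (fun=> (2^-1)%:E)); last first.
  by move=> k _; rewrite ord_extendE (eps_sign rad).
rewrite [X in (_ * X)%E](eq_bigr (fun k : 'I_n => (p (x k))%:E)); last first.
  by move=> k _; rewrite ord_extendE fineK// fin_num_measure//; exact: mQ0.
by rewrite !prodEFin -EFinM/= prodr_const card_ord exprVn.
Qed.

Let B := 3 * (v * ln (C * L * U / sigma)).

(** Where all signs are genuine, rounding the [n] block sums changes each signed sum by at most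
    [n * eta]. What remains is a function of the finite-valued [Q], whose law is uniform signs times
    a product sample. *)
Lemma mesh_bound :
  (\int[PA]_w (maxabs (fun j => \sum_(k < n) eps k.+1 w * path_sum (f j) (path_block R Z A m k.+1 w)))%:E
   <= (14400 * V * B + 180 * Num.sqrt (n%:R * sigma ^+ 2 * B) + n%:R * eta)%:E)%E.
Proof.
have B1 : 1 <= B.
  have := vLam_ge1 U_gt0 L_gt0 sigma_gt0 sigma_le vcF; rewrite /B; lra.
have cover (x : {ffun 'I_n -> X}) q : (0 < q)%N ->
    exists N (c : 'I_N -> 'I_n -> R), N%:R <= expR (q%:R * B) /\ forall j, exists i,
      \sum_k (g j (x k) - c i k) ^+ 2 <= (Num.sqrt n%:R * sigma / 2 ^+ q) ^+ 2.
  move=> q0; have [N [c [Nc cF]]] := covering_scale U_gt0 L_gt0 sigma_gt0 sigma_le vcF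
    (fun k => size_rep (x k)) q0.
  by exists N, c; split => // j; exact: (cF _ (Ff j)).
have gV j x : `|g j x| <= V by apply: path_sum_leV => //; exact: size_rep.
have bound := sample_radmean_le p_ge0 p_sum1 n_gt0 sigma_gt0 B1 V_gt0 gV g_sqr cover.
pose c (sx : {ffun 'I_n -> bool} * {ffun 'I_n -> X}) : R :=
  maxabs (fun j => radsum sx.1 (fun k => g j (sx.2 k))) + n%:R * eta.
have e0 := eta_gt0.
have ne0 : 0 <= n%:R * eta by rewrite mulr_ge0// ltW.
have c0 sx : 0 <= c sx by rewrite addr_ge0// maxabs_ge0.
have NS0 : PA (~` eps_signs eps) = 0%E.
  apply: etrans (probability_setC PA (measurable_eps_signs eps)) _.
  by rewrite (eps_signs_sure rad) subee.
apply: (@le_trans _ _ (\int[PA]_w (c (Q w))%:E)%E).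
  apply: (ae_ge0_le_integral_nonmeasurable (measurable_eps_signs eps) NS0).
  - by move=> w; rewrite lee_fin maxabs_ge0.
  - by move=> w; rewrite lee_fin.
  - apply/measurable_EFinP => _ Y _; rewrite setTI.
    rewrite (_ : _ @^-1` Y = \bigcup_(x in [set x | Y (c x)]) (Q @^-1` [set x])).
      by apply: fin_bigcup_measurable => //; exact: finite_finset.
    by apply/seteqP; split=> w /=; [move=> h; exists (Q w)|move=> [x Yx ->]].
  move=> w sw; rewrite lee_fin; apply: maxabs_le => // j.
  pose b k := path_block R Z A m k.+1 w.
  have -> : \sum_(k < n) eps k.+1 w * path_sum (f j) (b k) =
      radsum (Q w).1 (fun k : 'I_n => g j ((Q w).2 k)) +
      \sum_(k < n) eps k.+1 w * (path_sum (f j) (b k) - g j (cells (b k))).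
    rewrite /radsum -big_split/=; apply: eq_bigr => k _.
    by rewrite !ffunE -(eps_signE _ sw) -mulrDr addrC subrK.
  apply: le_trans (ler_normD _ _) _; apply: lerD.
    exact: (ler_maxabs (fun j => radsum (Q w).1 (fun k : 'I_n => g j ((Q w).2 k)))).
  apply: le_trans (ler_norm_sum _ _ _) _.
  rewrite [leRHS]mulr_natl -[n in leRHS]card_ord -sumr_const.
  apply: ler_sum => k _.
  rewrite normrM (eps_signE _ sw) normr_sign mul1r; apply: g_close.
  exact: size_path_block.
rewrite (expectation_finite PA mQ c0) lee_fin /c.
have -> : \sum_sx fine (PA (Q @^-1` [set sx])) * c sx =
    sample_mean p (fun x : {ffun 'I_n -> X} => radmean (fun e =>
      maxabs (fun j => radsum e (fun k => g j (x k))))) + n%:R * eta.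
  rewrite /c; under eq_bigr do rewrite mulrDr.
  rewrite big_split/= -mulr_suml (sum_law_finite PA mQ) mul1r; congr (_ + _).
  transitivity (\sum_(s : {ffun 'I_n -> bool}) \sum_(x : {ffun 'I_n -> X})
      fine (PA (Q @^-1` [set (s, x)])) *
      maxabs (fun j => radsum s (fun k => g j (x k)))).
    by rewrite pair_bigA; apply: eq_bigr => -[].
  rewrite exchange_big; apply: eq_bigr => x _.
  rewrite /radmean mulr_sumr mulr_sumr; apply: eq_bigr => s _.
  by rewrite law_Q; ring.
by rewrite lerD2r.
Qed.


End FixedMesh.

Let B := 3 * (v * ln (C * L * U / sigma)).

Definition truncated_sum (g : E -> R) (w : Om) : R :=
  \sum_(k < n) eps k.+1 w * path_sum g (path_block R Z A m k.+1 w).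

Let main : R := 3 * 14400 * (v * L * U * ln (C * L * U / sigma)
  + Num.sqrt (v * n%:R * sigma ^+ 2 * ln (C * L * U / sigma))).

Lemma finite_class_bound :
  (\int[PA]_w (maxabs (fun j => truncated_sum (f j) w))%:E <= main%:E)%E.
Proof.
apply/lee_addgt0Pr => e e0.
have n0 : (0 : R) < n%:R by rewrite ltr0n.
(* The mesh is chosen so that the rounding error [n * eta] is at most the arbitrary [e]. *)
have eta0 : 0 < Num.min sigma (e / n%:R) by rewrite lt_min sigma_gt0 divr_gt0.
have eta_le : Num.min sigma (e / n%:R) <= sigma by rewrite ge_min lexx.
apply: le_trans (mesh_bound eta0 eta_le) _; rewrite -EFinD lee_fin.
apply: lerD; last first.
  by rewrite mulrC -ler_pdivlMr// ge_min lexx orbT.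
have Lam0 := vLam_ge1 U_gt0 L_gt0 sigma_gt0 sigma_le vcF.
rewrite /main /V; set Lam := ln _ in Lam0 *.
have r0 : 0 <= v * n%:R * sigma ^+ 2 * Lam.
  rewrite (_ : _ * Lam = n%:R * sigma ^+ 2 * (v * Lam)); last by ring.
  by apply: mulr_ge0 (le_trans ler01 Lam0); rewrite mulr_ge0 ?sqr_ge0.
(* Since [3 <= 2 ^+ 2], the factor 3 leaves the root as 2, and [180 * 2] is far below
   [3 * 14400]. *)
have : Num.sqrt (n%:R * sigma ^+ 2 * (3 * (v * Lam))) <= 2 * Num.sqrt (v * n%:R * sigma ^+ 2 * Lam).
  rewrite -[2 in leRHS](ger0_norm (ler0n R 2)) -sqrtr_sqr -sqrtrM ?sqr_ge0// ler_wsqrtr//.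
  move: r0; set y := _ * Lam => r0.
  rewrite (_ : n%:R * _ * _ = 3 * y); last by rewrite /y; ring.
  by rewrite expr2; clearbody y; lra.
have := sqrtr_ge0 (v * n%:R * sigma ^+ 2 * Lam).
set c : R := 14400.
rewrite (_ : c * _ * _ = 3 * c * (v * L * U * Lam)); last by ring.
have : (180 : R) <= c by rewrite ler_nat.
move: (Num.sqrt _) (Num.sqrt _) => r s c180 s0 rs.
clearbody c; rewrite mulrDr; apply: lerD => //; nra.
Qed.

End FiniteSubclass.

Let main : R := 3 * 14400 * (v * L * U * ln (C * L * U / sigma)
  + Num.sqrt (v * n%:R * sigma ^+ 2 * ln (C * L * U / sigma))).

Lemma measurable_truncated_sum g : measurable_fun setT g ->
  measurable_fun setT (truncated_sum g).
Proof.
move=> mg; apply: measurable_sum => k; apply: measurable_funM => //.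
move=> _ Y mY; rewrite setTI.
apply: (measurable_path_block Z mA k.+1 (D := path_sum g @^-1` Y)).
by have := measurable_path_sum (S := S) mS m mg measurableT mY; rewrite setTI.
Qed.

Let supG (f : nat -> E -> R) N w := maxabs (fun j : 'I_N => truncated_sum (f j) w).

Let supG_mono f w : nondecreasing_seq (fun N => (supG f N w)%:E).
Proof.
apply/nondecreasing_seqP => N; rewrite lee_fin; apply: maxabs_le.
  exact: maxabs_ge0.
move=> j; exact: (ler_maxabs (fun j : 'I_N.+1 => truncated_sum (f j) w) (widen_ord (leqnSn N) j)).
Qed.

Let truncated_sup (f : nat -> E -> R) w : \bar R :=
  ereal_sup (range (fun N => (supG f N w)%:E)).

Let truncated_sup_lim f w : limn (fun N => (supG f N w)%:E) = truncated_sup f w.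
Proof. exact/cvg_lim/ereal_nondecreasing_cvgn/supG_mono. Qed.

Let truncated_sup_ge f i w : (`|truncated_sum (f i) w|%:E <= truncated_sup f w)%E.
Proof.
apply: (@le_trans _ _ (supG f i.+1 w)%:E); last by apply: ereal_sup_ubound; exists i.+1.
rewrite lee_fin.
exact: (ler_maxabs (fun j : 'I_i.+1 => truncated_sum (f j) w) ord_max).
Qed.

Let measurable_supG f N : (forall i, F (f i)) -> measurable_fun setT (fun w => (supG f N w)%:E).
Proof.
move=> Ff; apply/measurable_EFinP.
apply: measurable_maxabs => j; apply: measurable_truncated_sum.
by have [_ Fm _ _ _] := vcF; have [] := Fm _ (Ff j).
Qed.

Let measurable_truncated_sup f : (forall i, F (f i)) -> measurable_fun setT (truncated_sup f).
Proof.
move=> Ff; apply: (emeasurable_fun_cvg (fun N w => (supG f N w)%:E)).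
  by move=> N; exact: measurable_supG.
by move=> w _; exact/ereal_nondecreasing_cvgn/supG_mono.
Qed.

(** The bound for finitely many functions does not depend on their number, so it survives monotone
    convergence. *)
Let truncated_sup_bound f : (forall i, F (f i)) -> (\int[PA]_w truncated_sup f w <= main%:E)%E.
Proof.
move=> Ff; rewrite (eq_integral (fun w => limn (fun N => (supG f N w)%:E))); last first.
  by move=> w _; rewrite truncated_sup_lim.
have mG N := measurable_supG N Ff.
have G0 N w : setT w -> (0 <= (supG f N w)%:E)%E by rewrite lee_fin maxabs_ge0.
have mono w : setT w -> nondecreasing_seq (fun N => (supG f N w)%:E) by move=> _; exact: supG_mono.
rewrite monotone_convergence//.
apply: lime_le.
  by apply/cvg_ex; eexists; exact: (cvg_monotone_convergence _ mG G0 mono).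
by apply: nearW => N; apply: finite_class_bound => j; exact: Ff.
Qed.

(** Index [l] stands for length [l.+1]; the block is emptied exactly when [m <= l], that is when
    [l.+1] exceeds [L], and then its whole length is charged. *)
Let cost (l : nat) : R := if (m <= l)%N then l.+1%:R else 0.

Let cost_ge0 l : 0 <= cost l. Proof. by rewrite /cost; case: ifP. Qed.

(* The part of the length of the [k]-th block that exceeds the truncation level. *)
Let tail k w : \bar R := (\sum_(l <oo) (cost l)%:E * (\1_(after R Z A k (hit A l)) w)%:E)%E.

Let tail0 w : \bar R := (\sum_(l <oo) (cost l)%:E * (\1_(future Z 0 @^-1` hit A l) w)%:E)%E.

Let tail_term_ge0 l (D : set Om) w : (0 <= (cost l)%:E * (\1_D w)%:E)%E.
Proof. by rewrite mule_ge0 ?lee_fin. Qed.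

Let measurable_tail_term l (D : set Om) : measurable D ->
  measurable_fun setT (fun w => (cost l)%:E * (\1_D w)%:E)%E.
Proof.
move=> mD; apply: emeasurable_funM; first exact: measurable_cst.
by apply/measurable_EFinP; exact: measurable_indic.
Qed.

Let mafter k l : measurable (after R Z A k (hit A l)).
Proof. by apply: (measurable_after Z mA k); exact: measurable_hit. Qed.

Let mfuture l : measurable (future Z 0 @^-1` hit A l).
Proof.
by rewrite -[X in measurable X]setTI; apply: measurable_future => //; exact: measurable_hit.
Qed.

Let integral_tail k : (0 < k)%N -> (\int[PA]_w tail k w = \int[PA]_w tail0 w)%E.
Proof.
move=> k0; rewrite !integral_nneseries//; try by move=> l; exact: measurable_tail_term.
apply: eq_eseriesr => l _.
rewrite !ge0_integralZl ?lee_fin//; try by apply/measurable_EFinP; exact: measurable_indic.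
by congr (_ * _)%E; rewrite [LHS]integral_indic// [RHS]integral_indic// !setIT; exact: split_block_length.
Qed.

Let measurable_tail k : measurable_fun setT (tail k).
Proof. by apply: ge0_emeasurable_sum => // l _; exact: measurable_tail_term. Qed.

Let measurable_tail0 : measurable_fun setT tail0.
Proof. by apply: ge0_emeasurable_sum => // l _; exact: measurable_tail_term. Qed.

Let F_le f x : F f -> `|f x| <= U.
Proof. by move=> Ff; have [_ Fm _ _ _] := vcF; have [_ ->] := Fm f Ff. Qed.

Let tail_hit k l s w : ev R Z A k s w -> hit A l (future Z s w) ->
  ((cost l)%:E <= tail k w)%E.
Proof.
move=> es hl; apply: (@le_trans _ _ ((cost l)%:E * (\1_(after R Z A k (hit A l)) w)%:E)%E).
  by rewrite indicE mem_set ?mule1//; exists s.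
rewrite /tail (nneseriesD1 (n := l))//; first by rewrite leeDl// nneseries_ge0.
Qed.

Let block_sum_le f k w : F f -> finite_time R Z A k.+1 w ->
  (`|block_sum S Z f k w - path_sum f (path_block R Z A m k w)|%:E <= U%:E * tail k w)%E.
Proof.
move=> Ff [t _ et]; have [s _ es] := ev_pred et; have [l tl hl] := (evS_hit t es).1 et.
have U0 := U_gt0; rewrite tl in et.
apply: (@le_trans _ _ (U%:E * (cost l)%:E)%E); last first.
  by rewrite lee_pmul2l ?lte_fin//; exact: tail_hit es hl.
rewrite -EFinM lee_fin (block_sum_finite f es et) (path_blockE m es) (first_block_hit m hl).
rewrite /cost; case: ltnP => lm.
  by rewrite path_sum_mkseq subrr normr0 mulr0.
rewrite /path_sum big_nil subr0 mulrC -[l.+1 in leRHS]card_ord mulr_natl -sumr_const.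
by apply: le_trans (ler_norm_sum _ _ _) _; apply: ler_sum => i _; exact: F_le.
Qed.

Let block_rademacher_le (f : nat -> E -> R) : F = range f ->
  (block_rademacher S Z PA eps n F <= main%:E + (n%:R * U)%:E * \int[PA]_w tail0 w)%E.
Proof.
move=> Ff; have FE i : F (f i) by rewrite Ff; exists i.
pose N := eps_signs eps `&` \bigcap_k finite_time R Z A k.
have mN : measurable N.
  apply: measurableI; first exact: measurable_eps_signs.
  by apply: bigcapT_measurable => k; exact: measurable_finite_time.
have N0 : PA (~` N) = 0%E.
  apply: etrans (probability_setC PA mN) _.
  suff -> : PA N = 1%E by rewrite subee.
  rewrite probability_setI_sure//.
  - by apply: probability_bigcap_sure => k; [exact: measurable_finite_time|exact: split_finite_time].
  - exact: measurable_eps_signs.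
  - by apply: bigcapT_measurable => k; exact: measurable_finite_time.
  - exact: eps_signs_sure rad.
have tail_ge0 k w : (0 <= tail k w)%E by rewrite nneseries_ge0.
have U0 := U_gt0.
have Utail_ge0 k w : (0 <= U%:E * tail k w)%E by rewrite mule_ge0// lee_fin ltW.
have trunc_ge0 w : (0 <= truncated_sup f w)%E.
  by apply: le_trans (truncated_sup_ge f 0 w); rewrite lee_fin.
have mtrunc := measurable_truncated_sup FE.
have mUtail k : measurable_fun setT (fun w => U%:E * tail k w)%E.
  by apply: emeasurable_funM => //; exact: measurable_tail.
apply: (@le_trans _ _ (\int[PA]_w (truncated_sup f w + \sum_(k < n) U%:E * tail k.+1 w))%E).
  apply: (ae_ge0_le_integral_nonmeasurable mN N0).
  - move=> w; apply: (@le_trans _ _ `|\sum_(1 <= k < n.+1) eps k w * block_sum S Z (f 0%N) k w|%:E).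
      by rewrite lee_fin.
    by apply: ereal_sup_ubound; exists (f 0%N).
  - by move=> w; rewrite adde_ge0// sume_ge0.
  - by apply: emeasurable_funD => //; exact: emeasurable_sum.
  move=> w [sw fw]; apply: ge_ereal_sup => _ [h Fh <-].
  have [i _ hE] : range f h by rewrite -Ff.
  apply: (@le_trans _ _ (`|truncated_sum h w|%:E +
      \sum_(k < n) `|block_sum S Z h k.+1 w - path_sum h (path_block R Z A m k.+1 w)|%:E)%E).
    rewrite sumEFin -EFinD lee_fin big_add1/= big_mkord.
    have -> : \sum_(k < n) eps k.+1 w * block_sum S Z h k.+1 w = truncated_sum h w +
        \sum_(k < n) eps k.+1 w *
          (block_sum S Z h k.+1 w - path_sum h (path_block R Z A m k.+1 w)).
      by rewrite -big_split/=; apply: eq_bigr => k _; rewrite -mulrDr addrC subrK.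
    apply: le_trans (ler_normD _ _) _; rewrite lerD2l.
    apply: le_trans (ler_norm_sum _ _ _) _; apply: ler_sum => k _.
    by rewrite normrM (eps_signE _ sw) normr_sign mul1r.
  apply: leeD; first by rewrite -hE; exact: truncated_sup_ge.
  by apply: lee_sum => k _; apply: block_sum_le => //; exact: fw.
rewrite ge0_integralD//; last 2 first.
- by move=> w _; rewrite sume_ge0.
- exact: emeasurable_sum.
apply: leeD; first exact: truncated_sup_bound.
rewrite ge0_integral_sum//.
rewrite (eq_bigr (fun=> U%:E * \int[PA]_w tail0 w)%E); last first.
  by move=> k _; rewrite -(integral_tail (ltn0Sn k)) ge0_integralZl ?lee_fin ?(ltW U0)//;
    exact: measurable_tail.
rewrite -ge0_sume_distrl; last by move=> k _; rewrite lee_fin ltW.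
by rewrite sumEFin sumr_const card_ord mulr_natl.
Qed.

(** Markov's inequality in integrated form: on long cycles [c] times the length is dominated by [h],
    and on the others [tail0] is 0. *)
Let tail0_le (h : Om -> \bar R) (c : R) : 0 < c -> (forall w, (0 <= h w)%E) ->
  (forall l w, L < l.+1%:R -> ev R Z A 1 l.+1 w -> ((c * l.+1%:R)%:E <= h w)%E) ->
  (\int[PA]_w tail0 w <= (\int[PA]_w h w) * (c^-1)%:E)%E.
Proof.
move=> c0 h0 hL; rewrite muleC lee_pdivlMl// -ge0_integralZl ?lee_fin ?(ltW c0)//; last first.
  by move=> w _; rewrite nneseries_ge0.
apply: ge0_le_integral_nonmeasurable => w.
  by rewrite mule_ge0 ?nneseries_ge0// lee_fin ltW.
have [[l hl]|nh] := pselect (exists l, hit A l (future Z 0 w)); last first.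
  rewrite /tail0 eseries0 ?mule0// => l _ _.
  by rewrite indicE memNset ?mule0// => hl; apply: nh; exists l.
have -> : tail0 w = (cost l)%:E.
  rewrite /tail0 (nneseriesD1 (n := l))// eseries0 ?adde0.
    by rewrite indicE mem_set// mule1.
  move=> i _ /andP[_ /eqP il].
  by rewrite indicE memNset ?mule0// => hi; apply: il; exact: hit_inj hi hl.
rewrite /cost; case: ifPn => ml; last by rewrite mule0.
apply: hL; first by rewrite -truncn_le_nat.
by apply/(evS_hit _ (ev0 Z A w)); exists l.
Qed.

Lemma block_rademacher_bound (h : Om -> \bar R) (c : R) :
  0 < c -> (forall w, (0 <= h w)%E) ->
  (forall l w, L < l.+1%:R -> regen_time R S Z 1 w = l.+1%:R%:E -> ((c * l.+1%:R)%:E <= h w)%E) ->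
  (block_rademacher S Z PA eps n F <=
   main%:E + (n%:R * U)%:E * (\int[PA]_w h w) * (c^-1)%:E)%E.
Proof.
move=> c0 h0 hL; have [cF _ _ _ _] := vcF.
have main0 : 0 <= main.
  have Lam0 := vLam_ge1 U_gt0 L_gt0 sigma_gt0 sigma_le vcF.
  rewrite /main; set Lam := ln _ in Lam0 *.
  apply: mulr_ge0; first exact: mulr_ge0 (ler0n _ _) (ler0n _ _).
  apply: addr_ge0; last exact: sqrtr_ge0.
  rewrite (_ : _ * Lam = v * Lam * V); last by rewrite /V; ring.
  exact: mulr_ge0 (le_trans ler01 Lam0) (ltW V_gt0).
have [F0|/set0P[f0 Ff0]] := eqVneq F set0.
  apply: (@le_trans _ _ 0%E).
    rewrite /block_rademacher F0; under eq_integral do rewrite image_set0 ereal_sup0.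
    by rewrite integral_cst// mule_le0_ge0.
  have h0' : (0 <= \int[PA]_w h w)%E by exact: integral_ge0.
  apply: adde_ge0; first by rewrite lee_fin.
  apply: mule_ge0; last by rewrite lee_fin invr_ge0 ltW.
  by apply: mule_ge0 => //; rewrite lee_fin; apply: mulr_ge0 => //; exact: ltW.
have [phi phi_inj] := pcard_injP cF.
pose f i := if pselect (exists2 g, F g & phi g = i) is left e then projT1 (cid2 e) else f0.
have Ff : F = range f.
  apply/seteqP; split=> [g Fg|_ [i _ <-]].
    exists (phi g) => //; rewrite /f; case: pselect => [e|[]]; last by exists g.
    by case: cid2 => /= g' Fg' /phi_inj; apply; exact: mem_set.
  by rewrite /f; case: pselect => // e; case: cid2.
apply: le_trans (block_rademacher_le Ff) _; rewrite -muleA leeD2l//.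
apply: lee_wpmul2l; first by rewrite lee_fin mulr_ge0// ltW.
exact: tail0_le.
Qed.

End SplitChain.

(** * The bounds under polynomial and exponential moments *)

Unset Implicit Arguments.

Theorem theorem4 (R : realType) :
  exists M : R, 0 < M /\
  forall (d : measure_display) (E : measurableType d)
    (P : R.-pker E ~> E) (nu : probability E R)
    (* the chain X, with its laws under all initial distributions *)
    (dX : measure_display) (OmX : measurableType dX)
    (Pr : probability E R -> probability OmX R) (X : nat -> {mfun OmX >-> E})
    (psi : {measure set E -> \bar R})
    (S : set E) (delta : R) (Psi : probability E R)
    (* the split chain Z started in the atom, and the Rademacher variables *)
    (dZ : measure_display) (OmZ : measurableType dZ) (PA : probability OmZ R)
    (Z : nat -> {mfun OmZ >-> (E * bool)%type}) (eps : nat -> {mfun OmZ >-> R})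
    (F : set (E -> R)) (U C v sigma : R),
  countably_generated E ->
  markov_family P Pr X ->
  positive_harris P psi Pr X ->
  aperiodic P psi ->
  small_set P 1 S delta Psi ->
  (ereal_sup [set (\int[Pr \d_x]_w tau R X S w)%E | x in S] < +oo)%E ->
  (\int[Pr nu]_w tau R X S w < +oo)%E ->
  split_chain_from_atom P S delta Psi PA Z ->
  rademacher_indep_of_blocks S Z PA eps ->
  0 < U ->
  vc_type F (cst U) C v ->
  (forall f, F f ->
     (\int[PA]_w ((cycle_sum S Z f w) ^+ 2)%:E <= (sigma ^+ 2)%:E)%E) ->
  forall (n : nat) (L : R), (1 <= n)%N -> 0 < sigma -> sigma <= L * U ->
  let tauA := regen_time R S Z 1 in
  let main := M * (v * L * U * ln (C * L * U / sigma)
                   + Num.sqrt (v * n%:R * sigma ^+ 2 * ln (C * L * U / sigma))) in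
  (forall p : R, 1 < p -> (\int[PA]_w (tauA w `^ p) < +oo)%E ->
     (block_rademacher S Z PA eps n F <=
      main%:E + (n%:R * U)%:E * (\int[PA]_w (tauA w `^ p))
                * ((L `^ (p - 1))^-1)%:E)%E) /\
  (forall lam : R, 0 < lam ->
     (\int[PA]_w expeR (lam%:E * tauA w) < +oo)%E ->
     let Clam := (2%:E * (\int[PA]_w expeR (lam%:E * tauA w)) * (lam^-1)%:E)%E in
     (block_rademacher S Z PA eps n F <=
      main%:E + (n%:R * U * expR (- L * lam / 2))%:E * Clam)%E).
Proof.
(* 14400 comes from the finite-sample bound and 3 from the entropy
   [3 * v * ln (C * L * U / sigma)]. *)
exists (3 * 14400); split; first by apply: mulr_gt0; rewrite ltr0n.
move=> d E P nu dX OmX Pr X psi S delta Psi dZ OmZ PA Z eps F U C v sigma.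
move=> _ _ _ _ small _ _ chain rad U0 vcF variance n L n0 sigma0 sigma_le tauA main.
have L0 : 0 < L by rewrite -(pmulr_lgt0 _ U0); exact: lt_le_trans sigma_le.
have mA := measurable_atom small.
split=> [p p1 fin|lam lam0 fin].
  have h0 w : (0 <= tauA w `^ p)%E by exact: poweR_ge0.
  have fin1 : PA (finite_time R Z (atom S) 1) = 1%E.
    apply: (finite_time_integrable mA h0 _ fin) => w tau_oo.
    by rewrite /tauA tau_oo poweRyr// gt_eqF// (lt_trans ltr01).
  (* Here [c = L ^ (p - 1)]: a length [t > L] satisfies [L ^ (p - 1) * t <= t ^ p]. *)
  apply: (block_rademacher_bound small chain fin1 rad U0 L0 sigma0 sigma_le n0 vcF variance) => //.
    exact: powR_gt0.
  move=> l w Ll; rewrite /tauA => ->; rewrite poweR_EFin lee_fin.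
  have l0 : (0 : R) < l.+1%:R by rewrite ltr0n.
  have -> : l.+1%:R `^ p = l.+1%:R `^ (p - 1) * l.+1%:R :> R.
    rewrite -[in LHS](subrK 1 p) [LHS]powRD ?powRr1 ?ler0n//.
    by apply/implyP => _; exact: lt0r_neq0.
  rewrite ler_pM2r//.
  by rewrite ge0_ler_powR ?nnegrE ?subr_ge0 ?ltW.
cbv zeta.
have h0 w : (0 <= expeR (lam%:E * tauA w))%E by exact: expeR_ge0.
have fin1 : PA (finite_time R Z (atom S) 1) = 1%E.
  apply: (finite_time_integrable mA h0 _ fin) => w tau_oo.
  by rewrite /tauA tau_oo gt0_muley ?lte_fin.
(* Half of the exponent dominates the length through [u <= expR u] at [u = lam * t / 2]; the other
   half is at least [L * lam / 2] for [t > L]. Dividing by this constant produces the factor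
   [expR (- L * lam / 2)] and the [2 / lam] in [Clam]. *)
have c0 : 0 < lam / 2 * expR (L * lam / 2) by rewrite mulr_gt0 ?expR_gt0// divr_gt0.
apply: le_trans (block_rademacher_bound small chain fin1 rad U0 L0 sigma0 sigma_le n0 vcF
  variance c0 h0 _) _.
  move=> l w Ll; rewrite /tauA => ->; rewrite -EFinM /= lee_fin.
  set t : R := l.+1%:R in Ll *.
  have -> : lam * t = lam * t / 2 + lam * t / 2 by field.
  rewrite expRD (_ : _ * t = (lam * t / 2) * expR (L * lam / 2)); last by ring.
  have t0 : 0 <= lam * t / 2 by rewrite divr_ge0 ?mulr_ge0 ?ler0n ?(ltW lam0).
  apply: ler_pM => //.
    by apply: le_trans (expR_ge1Dx _); lra.
  by rewrite ler_expR ler_pM2r// mulrC ler_pM2l// ltW.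
rewrite leeD2l//.
have I_fin : (\int[PA]_w expeR (lam%:E * tauA w))%E \is a fin_num.
  by rewrite ge0_fin_numE//; exact: integral_ge0.
rewrite -(fineK I_fin) -!EFinM lee_fin le_eqVlt; apply/orP; left; apply/eqP.
rewrite !mulNr expRN; have := expR_gt0 (L * lam / 2); set e := expR _ => e0.
by field; rewrite !gt_eqF.
Qed.
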